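(* Let $n\in\mathbb{Z}$ and let $\rho:\pi_n\to\mathrm{SL}_2(\mathbb{C})$ be an irreducible representation of the group of the twist knot $J(2,2n)$ with $\operatorname{tr}\rho(a)=\operatorname{tr}\rho(ab)$. Then $\rho$ is non-acyclic if and only if $\rho(a^{-1}w^n)$ is of order $3$.
   Context: The group of the twist knot $J(2,2n)$ is $\pi_n=\langle a,b\mid aw^n=w^nb\rangle$ with $w=[a,b^{-1}]=ab^{-1}a^{-1}b$. A representation $\rho$ is acyclic if $H_i(\pi_n,\rho)=0$ for every $i$ (group homology with local coefficients in $\mathbb{C}^2$ via $\rho$), and non-acyclic otherwise. *)

(* Defs.v *)
From HB Require Import structures.
From mathcomp Require Import all_boot all_order all_algebra.
From mathcomp Require Import finmap generic_quotient complex.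
From mathcomp Require Import boolp reals.
From mathcomp.multinomials Require Import monalg.

Set Implicit Arguments.
Unset Strict Implicit.
Unset Printing Implicit Defensive.

Import GRing.Theory.
Local Open Scope ring_scope.
Local Open Scope quotient_scope.

Section IntegerPower.
Variable G : groupType.

Definition gexpz (x : G) (n : int) : G :=
  match n with
  | Posz k => (x ^+ k)%g
  | Negz k => (x ^- k.+1)%g
  end.

Definition has_order (x : G) (d : nat) : Prop :=
  [/\ (0 < d)%N, (x ^+ d)%g = 1%g
    & forall e : nat, (0 < e < d)%N -> (x ^+ e)%g <> 1%g].

End IntegerPower.

(* A letter (x, true) stands for the generator x, and (x, false) for x^-1. *)
Definition word (X : choiceType) := seq (X * bool).

Section Words.
Variable X : choiceType.

Definition letter_inv (l : X * bool) : X * bool := (l.1, ~~ l.2).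

Definition word_inv (u : word X) : word X := rev (map letter_inv u).

Definition word_exp (u : word X) (n : int) : word X :=
  match n with
  | Posz k => flatten (nseq k u)
  | Negz k => flatten (nseq k.+1 (word_inv u))
  end.

Lemma letter_invK : involutive letter_inv.
Proof. by case=> x b; rewrite /letter_inv /= negbK. Qed.

Lemma word_invK : involutive word_inv.
Proof.
move=> u; rewrite /word_inv map_rev revK -map_comp.
by rewrite (eq_map (g := id)) ?map_id // => l /=; rewrite letter_invK.
Qed.

Lemma word_inv_cat u v : word_inv (u ++ v) = word_inv v ++ word_inv u.
Proof. by rewrite /word_inv map_cat rev_cat. Qed.

(* The group < X | u = v for all (u, v) such that rels u v > *)
Variable rels : word X -> word X -> Prop.

Inductive pres_eq : word X -> word X -> Prop :=
| pres_refl u : pres_eq u u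
| pres_sym u v : pres_eq u v -> pres_eq v u
| pres_trans u v w : pres_eq u v -> pres_eq v w -> pres_eq u w
| pres_cancel u v l : pres_eq (u ++ [:: l; letter_inv l] ++ v) (u ++ v)
| pres_rel u v r s : rels r s -> pres_eq (u ++ r ++ v) (u ++ s ++ v).

Lemma pres_catl w u v : pres_eq u v -> pres_eq (w ++ u) (w ++ v).
Proof.
elim=> {u v} [u|u v _|u v z _ + _|u v l|u v r s Hrs].
- exact: pres_refl.
- exact: pres_sym.
- exact: pres_trans.
- by rewrite !(catA w); apply: pres_cancel.
- by rewrite !(catA w u); apply: pres_rel.
Qed.

Lemma pres_catr w u v : pres_eq u v -> pres_eq (u ++ w) (v ++ w).
Proof.
elim=> {u v} [u|u v _|u v z _ + _|u v l|u v r s Hrs].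
- exact: pres_refl.
- exact: pres_sym.
- exact: pres_trans.
- by rewrite -!catA; apply: (pres_cancel u (v ++ w)).
- by rewrite -!catA; apply: pres_rel.
Qed.

Lemma pres_cat u u' v v' :
  pres_eq u u' -> pres_eq v v' -> pres_eq (u ++ v) (u' ++ v').
Proof. by move=> /(pres_catr v) + /(pres_catl u'); apply: pres_trans. Qed.

Lemma pres_mulwV u : pres_eq (u ++ word_inv u) [::].
Proof.
elim/last_ind: u => [|u l IHu]; first exact: pres_refl.
rewrite -cats1 word_inv_cat -catA; apply: pres_trans IHu.
exact: (pres_cancel u (word_inv u) l).
Qed.

Lemma pres_mulVw u : pres_eq (word_inv u ++ u) [::].
Proof. by have := pres_mulwV (word_inv u); rewrite word_invK. Qed.

Lemma pres_inv u v : pres_eq u v -> pres_eq (word_inv u) (word_inv v).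
Proof.
move=> uv; apply: (@pres_trans _ (word_inv u ++ (v ++ word_inv v))).
  by rewrite -[X in pres_eq X _]cats0; apply/pres_catl/pres_sym/pres_mulwV.
rewrite catA -[X in pres_eq _ X]cat0s; apply: pres_catr.
by apply: pres_trans (pres_mulVw u); apply/pres_catl/pres_sym.
Qed.

Definition pres_eqb : rel (word X) := fun u v => `[< pres_eq u v >].

Lemma pres_eqb_refl : reflexive pres_eqb.
Proof. by move=> u; apply/asboolP/pres_refl. Qed.

Lemma pres_eqb_sym : symmetric pres_eqb.
Proof. by move=> u v; apply: asbool_equiv_eq; split; apply: pres_sym. Qed.

Lemma pres_eqb_trans : transitive pres_eqb.
Proof.
by move=> v u w /asboolP uv /asboolP vw; apply/asboolP/pres_trans/vw.
Qed.

Canonical pres_equiv := EquivRel pres_eqb pres_eqb_refl pres_eqb_sym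
  pres_eqb_trans.

Definition presented := {eq_quot pres_equiv}.
HB.instance Definition _ := Choice.on presented.
HB.instance Definition _ := EqQuotient.on presented.

Definition pres_class (u : word X) : presented := \pi_presented u.

Lemma pres_classP u v : pres_class u = pres_class v <-> pres_eq u v.
Proof.
split=> [/eqmodP /asboolP //|uv]; by apply/eqmodP/asboolP.
Qed.

Lemma pres_class_repr (x : presented) : pres_class (repr x) = x.
Proof. exact: reprK. Qed.

Definition pres_mul (x y : presented) : presented :=
  pres_class (repr x ++ repr y).
Definition pres_one : presented := pres_class [::].
Definition pres_invg (x : presented) : presented :=
  pres_class (word_inv (repr x)).

Lemma pres_eq_repr u : pres_eq (repr (pres_class u)) u.
Proof. by apply/pres_classP; rewrite pres_class_repr. Qed.

Lemma pres_mulE u v :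
  pres_mul (pres_class u) (pres_class v) = pres_class (u ++ v).
Proof. by apply/pres_classP/pres_cat; apply: pres_eq_repr. Qed.

Lemma pres_invE u : pres_invg (pres_class u) = pres_class (word_inv u).
Proof. by apply/pres_classP/pres_inv/pres_eq_repr. Qed.

Lemma pres_mulA : associative pres_mul.
Proof.
move=> x y z; rewrite -[x]pres_class_repr -[y]pres_class_repr.
by rewrite -[z]pres_class_repr !pres_mulE catA.
Qed.

Lemma pres_mul1 : left_id pres_one pres_mul.
Proof. by move=> x; rewrite -[x]pres_class_repr pres_mulE. Qed.

Lemma pres_mulg1 : right_id pres_one pres_mul.
Proof. by move=> x; rewrite -[x]pres_class_repr pres_mulE cats0. Qed.

Lemma pres_mulV : left_inverse pres_one pres_invg pres_mul.
Proof.
move=> x; rewrite -[x]pres_class_repr pres_invE pres_mulE.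
exact/pres_classP/pres_mulVw.
Qed.

Lemma pres_mulgV : right_inverse pres_one pres_invg pres_mul.
Proof.
move=> x; rewrite -[x]pres_class_repr pres_invE pres_mulE.
exact/pres_classP/pres_mulwV.
Qed.

HB.instance Definition _ := isGroup.Build presented
  pres_mulA pres_mul1 pres_mulg1 pres_mulV pres_mulgV.

Definition pres_gen (x : X) : presented := pres_class [:: (x, true)].

End Words.

Section Universal.
Variables (X : choiceType) (rels : word X -> word X -> Prop) (H : groupType).
Variable f : X -> H.

Definition word_eval (u : word X) : H :=
  (\prod_(l <- u) (if l.2 then f l.1 else (f l.1)^-1))%g.

Lemma word_eval_cat u v : word_eval (u ++ v) = (word_eval u * word_eval v)%g.
Proof. exact: big_cat. Qed.

Hypothesis f_rels : forall r s, rels r s -> word_eval r = word_eval s.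

Lemma word_eval_pres u v : pres_eq rels u v -> word_eval u = word_eval v.
Proof.
elim=> {u v} [//|//|u v w _ -> _ //|u v l|u v r s /f_rels rs].
  rewrite !word_eval_cat {2}/word_eval !big_cons big_nil mulg1.
  by case: l => x [] /=; rewrite ?mulgV ?mulVg mul1g.
by rewrite !word_eval_cat rs.
Qed.

Lemma presented_universal : exists! g : presented rels -> H,
  {morph g : x y / (x * y)%g} /\ forall x, g (pres_gen rels x) = f x.
Proof.
pose g (x : presented rels) := word_eval (repr x).
have gE u : g (pres_class rels u) = word_eval u.
  exact/word_eval_pres/pres_eq_repr.
have classM u v : pres_class rels (u ++ v) =
  (pres_class rels u * pres_class rels v)%g by rewrite -pres_mulE.
exists g; split.
  split=> [x y|x]; last by rewrite gE /word_eval big_seq1.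
  rewrite -[x]pres_class_repr -[y]pres_class_repr -classM !gE.
  exact: word_eval_cat.
move=> h [hM hf]; apply: funext => x; rewrite -[x]pres_class_repr gE.
have h1 : h 1%g = 1%g.
  by apply: (mulgI (h 1%g)); rewrite -hM !mulg1.
elim: (repr x) => [|[y b] u IHu]; first by rewrite /word_eval big_nil -h1.
rewrite -cat1s word_eval_cat classM hM -IHu /word_eval big_seq1 /=.
congr (_ * _)%g; case: b => /=; first by rewrite -hf.
apply: (mulIg (f y)); rewrite mulVg -hf -hM -classM -h1.
by congr h; apply/esym/pres_classP/(pres_cancel rels [::] [::] (y, false)).
Qed.

End Universal.

Section TwistKnotGroup.
Variable n : int.

(* The generators a and b are encoded by the booleans true and false. *)
Definition tw_a : word bool := [:: (true, true)].
Definition tw_b : word bool := [:: (false, true)].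

(* w = [a, b^-1] = a b^-1 a^-1 b *)
Definition tw_w : word bool := tw_a ++ word_inv tw_b ++ word_inv tw_a ++ tw_b.

Inductive twist_rel : word bool -> word bool -> Prop :=
| TwistRel : twist_rel (tw_a ++ word_exp tw_w n) (word_exp tw_w n ++ tw_b).

Definition twist_group : groupType := presented twist_rel.

Definition twist_a : twist_group := pres_gen twist_rel true.
Definition twist_b : twist_group := pres_gen twist_rel false.

(* This is not MathComp's commutator [~ x, y] = x^-1 y^-1 x y. *)
Definition twist_w : twist_group :=
  (twist_a * twist_b^-1 * twist_a^-1 * twist_b)%g.

End TwistKnotGroup.

Section SpecialLinear.
Variables (m : nat) (F : comUnitRingType).

Record SL : predArgType := MkSL {SLval :> 'M[F]_m; _ : \det SLval == 1}.

HB.instance Definition _ := [isSub for SLval].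
HB.instance Definition _ := [Choice of SL by <:].

Lemma SL_det (A : SL) : \det A = 1.
Proof. by case: A => A /= /eqP. Qed.

Lemma SL_unit (A : SL) : SLval A \in unitmx.
Proof. by rewrite unitmxE SL_det unitr1. Qed.

Fact SL_mul_proof (A B : SL) : \det (A *m B) == 1.
Proof. by rewrite det_mulmx !SL_det mulr1. Qed.
Fact SL_one_proof : \det (1%:M : 'M[F]_m) == 1.
Proof. by rewrite det1. Qed.
Fact SL_inv_proof (A : SL) : \det (invmx A) == 1.
Proof. by rewrite det_inv SL_det invr1. Qed.

Definition SL_mul A B := MkSL (SL_mul_proof A B).
Definition SL_one := MkSL SL_one_proof.
Definition SL_inv A := MkSL (SL_inv_proof A).

Fact SL_mulA : associative SL_mul.
Proof. by move=> A B C; apply: val_inj; apply: mulmxA. Qed.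
Fact SL_mul1 : left_id SL_one SL_mul.
Proof. by move=> A; apply: val_inj; apply: mul1mx. Qed.
Fact SL_mulg1 : right_id SL_one SL_mul.
Proof. by move=> A; apply: val_inj; apply: mulmx1. Qed.
Fact SL_mulV : left_inverse SL_one SL_inv SL_mul.
Proof. by move=> A; apply: val_inj; apply: mulVmx (SL_unit A). Qed.
Fact SL_mulgV : right_inverse SL_one SL_inv SL_mul.
Proof. by move=> A; apply: val_inj; apply: mulmxV (SL_unit A). Qed.

HB.instance Definition _ := isGroup.Build SL
  SL_mulA SL_mul1 SL_mulg1 SL_mulV SL_mulgV.

End SpecialLinear.

Notation "''SL_' m [ F ]" := (SL m F)
  (at level 8, m at level 2, format "''SL_' m [ F ]") : type_scope.

Section Representations.
Variables (G : groupType) (F : fieldType) (m : nat).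
Variable rho : {multiplicative G -> 'SL_m.+1[F]}.

(* G acts on F^(m+1) (column vectors, nonzero space) by left multiplication. *)
Definition irreducible_rep : Prop :=
  forall U : {vspace 'cV[F]_m.+1},
    (forall (g : G) (v : 'cV[F]_m.+1), v \in U -> rho g *m v \in U) ->
    U = 0%VS \/ U = fullv.

(* The bar complex computing H_*(G, F^(m+1)_rho): a k-chain is a finite sum
   of terms v (x) [g_1 | ... | g_k], stored as a finitely supported function
   of (g_1, ..., g_k). *)
Definition bar_chain (k : nat) := {malg 'cV[F]_m.+1[k.-tuple G]}.

(* The i-th face, 0 <= i <= k+1, of [g_1 | ... | g_(k+1)]: it drops g_1 if
   i = 0, drops g_(k+1) if i = k+1, and replaces g_i, g_(i+1) by their product
   otherwise. Tuple indices start at 0. *)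
Definition bar_face (k : nat) (i : 'I_k.+2) (t : k.+1.-tuple G) :
    k.-tuple G :=
  [tuple (if (j.+1 < i)%N then tnth t (widen_ord (leqnSn k) j)
          else if j.+1 == i :> nat then
            (tnth t (widen_ord (leqnSn k) j) * tnth t (lift ord0 j))%g
          else tnth t (lift ord0 j)) | j < k].

(* The left module is turned into a right one through g |-> g^-1, so that
   the 0-th face of v (x) [g_1 | ... ] carries the coefficient rho(g_1)^-1 v. *)
Definition bar_coef (k : nat) (i : 'I_k.+2) (t : k.+1.-tuple G)
    (v : 'cV[F]_m.+1) : 'cV[F]_m.+1 :=
  if i == ord0 then rho (thead t)^-1%g *m v else v.

Definition bar_boundary (k : nat) (c : bar_chain k.+1) : bar_chain k :=
  \sum_(t <- msupp c) \sum_(i < k.+2)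
    (<< bar_coef i t c@_t *g bar_face i t >> *~ (-1) ^+ i).

Definition bar_cycle (k : nat) : bar_chain k -> Prop :=
  match k with
  | 0 => fun _ => True
  | k'.+1 => fun c => bar_boundary c = 0
  end.

Definition homology_vanishes (k : nat) : Prop :=
  forall c : bar_chain k, bar_cycle c ->
    exists d : bar_chain k.+1, bar_boundary d = c.

Definition acyclic_rep : Prop := forall k : nat, homology_vanishes k.

End Representations.

(* Main.v *)
(* Write x = tr a = tr b = tr ab and u = a w a^-1.

   A k-cochain e with coefficients in Hom(V, Q), Q the group of k-chains modulo
   boundaries, whose coboundary sends each chain to its class shows that every
   k-cycle bounds; so vanishing of homology follows from that of cohomology.

   In degrees k >= 3 cohomology vanishes for all coefficients. By dimension
   shifting this amounts to H^2 of a quotient of a coinduced module, and there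
   it says that the relator of a presentation can be prescribed freely in group
   extensions. The equation to be solved on functions on G is
     theta(g u) = theta(g),  theta(g w^-n) - theta(g) = given,
   which is possible because u and w^-n generate a free group. For this one lets
   G act on a set by HNN gluing: two free actions of a free group on the same
   set are conjugate as soon as their orbit sets are absorbed.

   In degrees at most 2 everything is governed by the 2x2 matrix of the Fox
   derivative of the relator with respect to b. Irreducibility forces
   (x + 1)(x - 2)^2 <> 0, and w^n = s w - (x - 1) s by the relation, so that
   det w^n = 1 reads (x (x - 2) s)^2 = 1, while tr(a^-1 w^n) = -x (x - 2) s.
   The Fox matrix is 1 - x (x - 2) s times an invertible matrix: it vanishes
   when tr(a^-1 w^n) = -1, i.e. in order 3, and is invertible otherwise. *)

From HB Require Import structures.
Require Import Defs.
From mathcomp Require Import all_boot all_order all_algebra.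
From mathcomp Require Import finmap generic_quotient ring_quotient complex.
From mathcomp Require Import boolp functions reals.
From mathcomp.multinomials Require Import monalg.
From mathcomp Require Import zify ring.

Set Implicit Arguments.
Unset Strict Implicit.
Unset Printing Implicit Defensive.

Import Order.TTheory GRing.Theory Num.Theory.
Local Open Scope ring_scope.

(** * Powers, words and bijections *)

Section IntegerPowers.
Variable G : groupType.
Implicit Types x y : G.

Lemma gexpzS x k : gexpz x (1 + k) = (x * gexpz x k)%g.
Proof.
case: k => [k|[|k]]; first by rewrite -intS /= expgS.
  by rewrite (_ : 1 + Negz 0 = 0) //= mulgV.
have -> : 1 + Negz k.+1 = Negz k by lia.
by rewrite /= -!expVgn [in RHS]expgS mulVKg.
Qed.

Lemma gexpzB1 x k : gexpz x (-1 + k) = (x^-1 * gexpz x k)%g.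
Proof. by rewrite -[in RHS](addrNK 1 k) [in RHS]addrC gexpzS mulKg addrC. Qed.

Lemma gexpzD x k l : gexpz x (k + l) = (gexpz x k * gexpz x l)%g.
Proof.
elim/int_rect: k => [|k IHk|k IHk]; first by rewrite add0r mul1g.
  by rewrite intS -addrA !gexpzS IHk mulgA.
by rewrite intS opprD -addrA !gexpzB1 IHk mulgA.
Qed.

Lemma gexpzN x k : gexpz x (- k) = (gexpz x k)^-1%g.
Proof. by apply: (mulgI (gexpz x k)); rewrite -gexpzD subrr mulgV. Qed.

Lemma gexpzJ x y k : gexpz (y * x * y^-1)%g k = (y * gexpz x k * y^-1)%g.
Proof.
elim/int_rect: k => [|k IHk|k IHk]; first by rewrite /= mulg1 mulgV.
  by rewrite intS !gexpzS IHk !mulgA mulgVK.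
by rewrite intS opprD !gexpzB1 IHk !invgM invgK !mulgA mulgVK.
Qed.

End IntegerPowers.

Section MorphismPowers.
Variables (G H : groupType) (f : G -> H).
Hypothesis fM : {morph f : x y / (x * y)%g}.

Lemma morph_1g : f 1%g = 1%g.
Proof. by apply: (mulgI (f 1%g)); rewrite -fM !mulg1. Qed.

Lemma morph_Vg x : f x^-1%g = (f x)^-1%g.
Proof. by apply: (mulgI (f x)); rewrite -fM !mulgV morph_1g. Qed.

Lemma morph_gexpz x k : f (gexpz x k) = gexpz (f x) k.
Proof.
elim/int_rect: k => [|k IHk|k IHk]; first exact: morph_1g.
  by rewrite intS !gexpzS fM IHk.
by rewrite intS opprD !gexpzB1 fM morph_Vg IHk.
Qed.

Lemma morph_word_eval (X : choiceType) (g : X -> G) u :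
  f (word_eval g u) = word_eval (fun x => f (g x)) u.
Proof.
rewrite /word_eval; elim: u => [|[x b] u IHu]; rewrite ?big_nil ?big_cons ?morph_1g //.
by rewrite fM IHu; case: b => //=; rewrite morph_Vg.
Qed.

End MorphismPowers.

Section WordEvaluation.
Variables (X : choiceType) (H : groupType).
Implicit Types (f : X -> H) (u : word X).

Lemma word_eval_nil f : word_eval f [::] = 1%g.
Proof. exact: big_nil. Qed.

Lemma word_eval_cons f l u :
  word_eval f (l :: u) = ((if l.2 then f l.1 else (f l.1)^-1) * word_eval f u)%g.
Proof. exact: big_cons. Qed.

Lemma word_eval_gen f x : word_eval f [:: (x, true)] = f x.
Proof. by rewrite word_eval_cons word_eval_nil mulg1. Qed.

Lemma word_eval_free f u v :
  pres_eq (fun _ _ => False) u v -> word_eval f u = word_eval f v.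
Proof. by apply: word_eval_pres. Qed.

Lemma word_eval_inv f u : word_eval f (word_inv u) = (word_eval f u)^-1%g.
Proof.
apply: (mulgI (word_eval f u)); rewrite -word_eval_cat mulgV.
by rewrite (word_eval_free f (pres_mulwV _ u)) word_eval_nil.
Qed.

Lemma word_eval_exp f u k : word_eval f (word_exp u k) = gexpz (word_eval f u) k.
Proof.
have pos v m : word_eval f (flatten (nseq m v)) = (word_eval f v ^+ m)%g.
  elim: m => [|m IHm]; first by rewrite word_eval_nil.
  by rewrite /= word_eval_cat IHm expgS.
by case: k => k; rewrite /word_exp pos ?word_eval_inv ?expVgn.
Qed.

Lemma eq_word_eval f g : f =1 g -> word_eval f =1 word_eval g.
Proof. by move=> /funext ->. Qed.

End WordEvaluation.

Lemma pres_class_eval (X : choiceType) (rels : word X -> word X -> Prop) u :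
  word_eval (pres_gen rels) u = pres_class rels u.
Proof.
elim: u => [|[x b] u IHu]; first by rewrite word_eval_nil.
have gE : (if b then pres_gen rels x else (pres_gen rels x)^-1)%g
    = pres_class rels [:: (x, b)].
  by case: b => //; rewrite [LHS]pres_invE.
by rewrite word_eval_cons IHu /= gE [LHS]pres_mulE.
Qed.

Record bijection (Z : Type) := Bijection {
  bij_fun :> Z -> Z; bij_inv : Z -> Z;
  bij_funK : cancel bij_fun bij_inv; bij_invK : cancel bij_inv bij_fun}.

Section BijectionGroup.
Variable Z : Type.
Implicit Types s t : bijection Z.

Lemma bijectionP s t : s =1 t -> s = t.
Proof.
case: s t => [f f' fK f'K] [g g' gK g'K] /= /funext fg; case: g / fg gK g'K => gK g'K.
have e : f' = g' by apply: funext => z; rewrite -{1}(g'K z) fK.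
by case: g' / e gK g'K => gK g'K; congr Bijection; apply: Prop_irrelevance.
Qed.

HB.instance Definition _ := gen_eqMixin (bijection Z).
HB.instance Definition _ := gen_choiceMixin (bijection Z).

Definition bij_mul s t : bijection Z :=
  Bijection (can_comp (@bij_funK _ s) (@bij_funK _ t))
            (can_comp (@bij_invK _ t) (@bij_invK _ s)).
Definition bij_one : bijection Z := @Bijection Z id id (frefl id) (frefl id).
Definition bij_inverse s : bijection Z := Bijection (@bij_invK _ s) (@bij_funK _ s).

Fact bij_mulA : associative bij_mul. Proof. by move=> *; apply: bijectionP. Qed.
Fact bij_mul1 : left_id bij_one bij_mul. Proof. by move=> *; apply: bijectionP. Qed.
Fact bij_mulg1 : right_id bij_one bij_mul. Proof. by move=> *; apply: bijectionP. Qed.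
Fact bij_mulV : left_inverse bij_one bij_inverse bij_mul.
Proof. by move=> s; apply: bijectionP => z; apply: bij_funK. Qed.
Fact bij_mulgV : right_inverse bij_one bij_inverse bij_mul.
Proof. by move=> s; apply: bijectionP => z; apply: bij_invK. Qed.

HB.instance Definition _ := isGroup.Build (bijection Z)
  bij_mulA bij_mul1 bij_mulg1 bij_mulV bij_mulgV.

Lemma bijM s t z : (s * t)%g z = s (t z). Proof. by []. Qed.
Lemma bijV s z : (s^-1)%g z = bij_inv s z. Proof. by []. Qed.

End BijectionGroup.

(** * Free families *)

Notation free_eq := (pres_eq (fun _ _ => False)).

(** Equivalently, the morphism from the free group on [X] induced by [f] is injective. *)
Definition free_family (X : choiceType) (H : groupType) (f : X -> H) : Prop :=
  forall u v : word X, word_eval f u = word_eval f v -> free_eq u v.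

Section FreeFamilies.
Variable X : choiceType.

Lemma free_family1 (H : groupType) (f : X -> H) :
  (forall u, word_eval f u = 1%g -> free_eq u [::]) -> free_family f.
Proof.
move=> f1 u v uv; apply: (@pres_trans _ _ _ ((u ++ word_inv v) ++ v)).
  rewrite -catA -[X in pres_eq _ X _]cats0; apply/pres_catl/pres_sym.
  exact: pres_mulVw.
rewrite -[X in pres_eq _ _ X]cat0s; apply/pres_catr/f1.
by rewrite word_eval_cat word_eval_inv uv mulgV.
Qed.

Lemma free_family_morph (H K : groupType) (h : H -> K) (f : X -> H) :
    {morph h : x y / (x * y)%g} ->
  free_family (fun x => h (f x)) -> free_family f.
Proof.
by move=> hM fr u v uv; apply: fr; rewrite -!(morph_word_eval hM) uv.
Qed.

Lemma free_family_inj (H K : groupType) (h : H -> K) (f : X -> H) :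
    {morph h : x y / (x * y)%g} -> injective h ->
  free_family f -> free_family (fun x => h (f x)).
Proof.
move=> hM h_inj fr u v; rewrite -!(morph_word_eval hM) => /h_inj.
exact: fr.
Qed.

Definition free_group : groupType := presented (fun _ _ : word X => False).
Definition free_gen : X -> free_group := pres_gen _.

(** The family [t] defines an endomorphism of the free group that is left inverse to the one defined
    by [s], so the latter is injective. *)
Lemma free_family_subst (H : groupType) (f : X -> H) (s : X -> word X)
    (t : X -> free_group) :
    (forall x, word_eval t (s x) = free_gen x) ->
  free_family f -> free_family (fun x => word_eval f (s x)).
Proof.
move=> ts fr u v.
pose S := word_eval (fun x => pres_class (fun _ _ : word X => False) (s x)).
have SE (K : groupType) (g : X -> K) z :
    word_eval (fun x => word_eval g (s x)) z = word_eval g (repr (S z)).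
  have [h [[hM hg] _]] := @presented_universal X (fun _ _ => False) K g
    (fun _ _ => False_ind _).
  have hE y : h (pres_class _ y) = word_eval g y.
    by rewrite -pres_class_eval (morph_word_eval hM); apply: eq_word_eval.
  rewrite -hE pres_class_repr (morph_word_eval hM).
  by apply: eq_word_eval => x; rewrite hE.
rewrite !SE => /fr uv; apply/pres_classP; rewrite -!pres_class_eval.
rewrite -!(eq_word_eval ts) !SE; exact: word_eval_free.
Qed.

(** A nonempty reduced word moves [z0] into the region [P l] of its first letter, which does not
    contain [z0]; hence it does not act as the identity. *)
Lemma ping_pong (Z : Type) (f : X -> bijection Z) (P : X * bool -> Z -> Prop)
    (z0 : Z) :
  (forall l, ~ P l z0) ->
  (forall (l : X * bool) z, z = z0 \/ (exists2 l', l' != letter_inv l & P l' z) ->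
     P l ((if l.2 then f l.1 else (f l.1)^-1)%g z)) ->
  free_family f.
Proof.
move=> P0 Pf; apply: free_family1 => u.
pose push (l : X * bool) (v : word X) :=
  if v is l' :: v' then if l' == letter_inv l then v' else l :: v else [:: l].
pose reduced := sorted (fun l l' : X * bool => l' != letter_inv l).
have push_eq l v : free_eq (l :: v) (push l v).
  case: v => [|l' v]; rewrite /push; first exact: pres_refl.
  case: eqP => [->|_]; last exact: pres_refl.
  exact: (pres_cancel _ [::] v l).
have push_red l v : reduced v -> reduced (push l v).
  case: v => [//|l' v] /= rv; case: ifPn => [_|nl]; last by rewrite /= nl.
  exact: path_sorted rv.
(* Every word is freely equal to a reduced one: letters are put in front one at a time and cancelled
   when possible. *)
have [v [uv rv]] : exists v, free_eq u v /\ reduced v.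
  elim: u => [|l u [v [uv rv]]]; first by exists [::]; split=> //; apply: pres_refl.
  exists (push l v); split; last exact: push_red.
  by apply: pres_trans (push_eq l v); apply: (@pres_catl _ _ [:: l]).
rewrite (word_eval_free f uv).
case: v rv uv => [//|l v rv _ ev1]; case: (P0 l).
rewrite -[z0]/((1%g : bijection Z) z0) -ev1 {ev1}.
elim: v l rv => [|l' v IHv] l /=.
  by move=> _; rewrite word_eval_cons word_eval_nil mulg1; apply: Pf; left.
case/andP=> nl rv; rewrite word_eval_cons bijM; apply: Pf.
by right; exists l' => //; apply: IHv.
Qed.

End FreeFamilies.

Section OrbitRepresentatives.
Variables (X : choiceType) (H : groupType) (f : X -> H).
Implicit Types (x y : H) (u : word X).

Definition orbit_rep x : H :=
  choose (fun y => `[< exists u, y = (word_eval f u * x)%g >]) x.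

Lemma orbit_repP x : exists u, x = (word_eval f u * orbit_rep x)%g.
Proof.
have : `[< exists u, orbit_rep x = (word_eval f u * x)%g >].
  apply: (@chooseP _ (fun y => `[< exists u, y = (word_eval f u * x)%g >]) x).
  by apply/asboolP; exists [::]; rewrite word_eval_nil mul1g.
case/asboolP=> u ->.
by exists (word_inv u); rewrite word_eval_inv mulKg.
Qed.

Definition orbit_word x : word X := projT1 (cid (orbit_repP x)).

Lemma orbit_wordK x : x = (word_eval f (orbit_word x) * orbit_rep x)%g.
Proof. exact: projT2 (cid (orbit_repP x)). Qed.

(** Two points of one orbit define the same predicate, and [choose] depends only on the predicate
    once the default point satisfies it. *)
Lemma orbit_rep_eval u x : orbit_rep (word_eval f u * x)%g = orbit_rep x.
Proof.
rewrite /orbit_rep; set P := fun y => _; set Q := fun y => _.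
have -> : P = Q.
  apply: funext => y; apply: asbool_equiv_eq; split=> -[v ->].
    by exists (v ++ u); rewrite word_eval_cat mulgA.
  by exists (v ++ word_inv u); rewrite word_eval_cat word_eval_inv -mulgA mulKg.
apply: choose_id; apply/asboolP; first by exists u.
by exists [::]; rewrite word_eval_nil mul1g.
Qed.

Lemma orbit_repK x : orbit_rep (orbit_rep x) = orbit_rep x.
Proof. by rewrite -[LHS](orbit_rep_eval (orbit_word x)) -orbit_wordK. Qed.

Hypothesis f_free : free_family f.

Lemma orbit_word_eval u x :
  free_eq (orbit_word (word_eval f u * x)%g) (u ++ orbit_word x).
Proof.
apply: f_free; apply: (mulIg (orbit_rep x)).
rewrite -{1}(orbit_rep_eval u) -orbit_wordK word_eval_cat -mulgA.
by rewrite -orbit_wordK.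
Qed.

Lemma orbit_word_rep x : orbit_rep x = x -> free_eq (orbit_word x) [::].
Proof.
move=> xr; apply: f_free; apply: (mulIg x); rewrite -{2}xr -orbit_wordK.
by rewrite word_eval_nil mul1g.
Qed.

(* On each orbit, theta is obtained by summing phi along reduced words. *)
Lemma free_family_solve (M : zmodType) (phi : X -> H -> M) :
  exists theta : H -> M, forall (x : X) y, theta (y * f x)%g - theta y = phi x y.
Proof.
(* Inversion turns right translation into left translation, the action to which orbit words refer;
   [psi] is the prescribed increment in these terms. *)
pose psi (x : X) y := - phi x ((f x * y)^-1)%g.
pose fix int (u : word X) (y : H) {struct u} : M :=
  if u is l :: v then
    (if l.2 then psi l.1 (word_eval f v * y)%g
     else - psi l.1 ((f l.1)^-1 * (word_eval f v * y))%g) + int v y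
  else 0.
have int_cat u v y : int (u ++ v) y = int u (word_eval f v * y)%g + int v y.
  elim: u => [|l u IHu] /=; first by rewrite add0r.
  by rewrite IHu word_eval_cat !mulgA addrA.
have int_eq u v y : free_eq u v -> int u y = int v y.
  elim=> {u v} [//|//|u v w _ -> _ //|u v l|//].
  have e := word_eval_free f (pres_cancel _ [::] v l).
  rewrite (int_cat u) (int_cat u v) e; congr (_ + _); rewrite int_cat /=.
  rewrite !word_eval_cons word_eval_nil /=.
  case: l {e} => x [] /=; rewrite mulg1 addr0 ?invgK mul1g -?mulgA.
    by rewrite subrr add0r.
  by rewrite mulKg addNr add0r.
pose sol y := int (orbit_word y) (orbit_rep y).
have solE (x : X) y : sol (f x * y)%g = psi x y + sol y.
  rewrite /sol -{1 2}(word_eval_gen f x) orbit_rep_eval.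
  rewrite (int_eq _ _ _ (orbit_word_eval _ _)) int_cat /= -orbit_wordK.
  by rewrite word_eval_nil mul1g addr0.
exists (fun y => sol y^-1)%g => x y /=.
have := solE x (y * f x)^-1%g; rewrite invgM mulVKg => ->.
by rewrite /psi mulVKg invgK opprD opprK addrCA subrr addr0.
Qed.

End OrbitRepresentatives.

Definition pair_family (T : Type) (x y : T) (b : bool) : T := if b then x else y.

Section PairFamilies.
Variable H : groupType.
Implicit Types x y : H.

Lemma free_pair_swap x y :
  free_family (pair_family x y) -> free_family (pair_family y x).
Proof.
move=> fr; pose s b : word bool := [:: (~~ b, true)].
have -> : pair_family y x = fun b => word_eval (pair_family x y) (s b).
  by apply: funext => -[]; rewrite word_eval_gen.
apply: (@free_family_subst _ _ _ s (fun b => free_gen (~~ b))) fr => b.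
by rewrite word_eval_gen negbK.
Qed.

(* A Nielsen transformation, with inverse [y |-> x^-k y x^-l]. *)
Lemma free_pair_nielsen x y k l : free_family (pair_family x y) ->
  free_family (pair_family x (gexpz x k * y * gexpz x l)%g).
Proof.
move=> fr; pose X : word bool := [:: (true, true)].
pose s b := if b then X else word_exp X k ++ [:: (false, true)] ++ word_exp X l.
have sE (K : groupType) (g : bool -> K) b : word_eval g (s b) =
    if b then g true else (gexpz (g true) k * g false * gexpz (g true) l)%g.
  rewrite /s /X; case: b; first by rewrite word_eval_gen.
  by rewrite !word_eval_cat !word_eval_exp !word_eval_gen mulgA.
rewrite (_ : pair_family _ _ = fun b => word_eval (pair_family x y) (s b)).
  pose a : free_group bool := free_gen true.
  apply: (@free_family_subst _ _ _ s (pair_family a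
    (gexpz a (- k) * free_gen false * gexpz a (- l)))%g) fr => b.
  rewrite sE; case: b => //=.
  by rewrite !mulgA -gexpzD subrr mul1g -!mulgA -gexpzD addNr mulg1.
by apply: funext => b; rewrite sE; case: b.
Qed.

End PairFamilies.

Section Shears.

Fact shear1_can : cancel (fun z : int * int => (z.1 + 3 * z.2, z.2))
                         (fun z => (z.1 - 3 * z.2, z.2)).
Proof. by case=> x y /=; rewrite addrK. Qed.
Fact shear1_canV : cancel (fun z : int * int => (z.1 - 3 * z.2, z.2))
                          (fun z => (z.1 + 3 * z.2, z.2)).
Proof. by case=> x y /=; rewrite addrNK. Qed.
Fact shear2_can : cancel (fun z : int * int => (z.1, z.2 + 3 * z.1))
                         (fun z => (z.1, z.2 - 3 * z.1)).
Proof. by case=> x y /=; rewrite addrK. Qed.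
Fact shear2_canV : cancel (fun z : int * int => (z.1, z.2 - 3 * z.1))
                          (fun z => (z.1, z.2 + 3 * z.1)).
Proof. by case=> x y /=; rewrite addrNK. Qed.

Definition shear1 := Bijection shear1_can shear1_canV.
Definition shear2 := Bijection shear2_can shear2_canV.

Lemma shear1_exp k z : gexpz shear1 k z = (z.1 + 3 * k * z.2, z.2).
Proof.
elim/int_rect: k => [|k IHk|k IHk].
- by rewrite mulr0 mul0r addr0; case: z.
- by rewrite intS gexpzS bijM IHk /=; congr pair; ring.
- by rewrite intS opprD gexpzB1 bijM IHk /=; congr pair; ring.
Qed.

Lemma shear2_exp k z : gexpz shear2 k z = (z.1, z.2 + 3 * k * z.1).
Proof.
elim/int_rect: k => [|k IHk|k IHk].
- by rewrite mulr0 mul0r addr0; case: z.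
- by rewrite intS gexpzS bijM IHk /=; congr pair; ring.
- by rewrite intS opprD gexpzB1 bijM IHk /=; congr pair; ring.
Qed.

(** As |c| >= 3, the term [c * y] dominates: [x + c * y] has its sign and absolute value at least
    2|y|. With |c| = 2 the first inequality could become an equality, whence the coefficient 3 in
    the shears. *)
Lemma shear_growth (c x y : int) : 9 <= c ^+ 2 -> y != 0 ->
  x ^+ 2 <= y ^+ 2 \/ 0 < c * x * y ->
  y ^+ 2 < (x + c * y) ^+ 2 /\ 0 < c * (x + c * y) * y.
Proof.
move=> c9 y0 h.
have y2 : 1 <= y ^+ 2 by nia.
have cy : 9 * y ^+ 2 <= c ^+ 2 * y ^+ 2 by nia.
case: h => h; split.
- have : 0 <= (c * y + 2 * x) ^+ 2 by apply: sqr_ge0.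
  nia.
- have : 0 <= (c * y + x) ^+ 2 by apply: sqr_ge0.
  nia.
- nia.
- nia.
Qed.

Lemma free_shears k l : k != 0 -> l != 0 ->
  free_family (pair_family (gexpz shear1 k) (gexpz shear2 l)).
Proof.
move=> k0 l0.
pose sg (b : bool) (m : int) := if b then 3 * m else - (3 * m).
have sg9 b m : m != 0 -> 9 <= sg b m ^+ 2 by rewrite /sg; case: b; nia.
(* [sg] gives the shift coefficient of a letter. In its region the coordinate that it changes
   dominates, and the product of the coordinates has the sign of that coefficient; (1, 1) lies in no
   region. *)
pose P (i : bool * bool) (z : int * int) :=
  if i.1 then z.2 ^+ 2 < z.1 ^+ 2 /\ 0 < sg i.2 k * z.1 * z.2
  else z.1 ^+ 2 < z.2 ^+ 2 /\ 0 < sg i.2 l * z.2 * z.1.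
have actE i z : (if i.2 then pair_family (gexpz shear1 k) (gexpz shear2 l) i.1
    else (pair_family (gexpz shear1 k) (gexpz shear2 l) i.1)^-1)%g z =
  if i.1 then (z.1 + sg i.2 k * z.2, z.2) else (z.1, z.2 + sg i.2 l * z.1).
  case: i => -[] [] /=; rewrite ?shear1_exp ?shear2_exp //.
    by rewrite -bijV -gexpzN shear1_exp mulrN.
  by rewrite -bijV -gexpzN shear2_exp mulrN.
apply: (@ping_pong _ _ _ P (1, 1)).
  by case=> -[] b [] /=; rewrite ltxx.
move=> i z hz; rewrite actE; case: i hz => -[] b hz; rewrite /P /=.
- apply: shear_growth; first exact: sg9.
    case: hz => [->//|[[[] c] _ [] /=]]; nia.
  case: hz => [->|[[[] c] nc [] /=]]; first by left.
    by move=> _ h; right; move: nc h; rewrite /sg; case: b; case: c.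
  by move=> h _; left; apply: ltW.
- apply: shear_growth; first exact: sg9.
    case: hz => [->//|[[[] c] _ [] /=]]; nia.
  case: hz => [->|[[[] c] nc [] /=]]; first by left.
    by move=> h _; left; apply: ltW.
  by move=> _ h; right; move: nc h; rewrite /sg; case: b; case: c.
Qed.

End Shears.

(** * The fibre group of a twist knot is free *)

Section Transporter.
Variables (X : choiceType) (H : groupType).

Definition orbit_reps (f : X -> H) := {x : H | orbit_rep f x == x}.

Definition orbit_rep_in (f : X -> H) (x : H) : orbit_reps f :=
  exist _ (orbit_rep f x) (introT eqP (orbit_repK f x)).

Definition seq_cons (T : Type) (x : T) (s : nat -> T) (i : nat) : T :=
  if i is j.+1 then s j else x.

(* For free f and g, left multiplication by f and by g on H x S become
   isomorphic once S absorbs the two orbit sets, which sequences do. *)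
Definition carrier (f g : X -> H) : Type :=
  (H * ((nat -> orbit_reps f) * (nat -> orbit_reps g)))%type.

(** The [f]-word of [z.1] is replayed over [g] from a representative popped off the second sequence,
    and the [f]-representative of [z.1] is pushed onto the first, so that nothing is lost. *)
Definition transport (f g : X -> H) (z : carrier f g) : carrier f g :=
  ((word_eval g (orbit_word f z.1) * val (z.2.2 0))%g,
   (seq_cons (orbit_rep_in f z.1) z.2.1, fun i => z.2.2 i.+1)).

Definition transport_inv (f g : X -> H) (z : carrier f g) : carrier f g :=
  ((word_eval f (orbit_word g z.1) * val (z.2.1 0))%g,
   (fun i => z.2.1 i.+1, seq_cons (orbit_rep_in g z.1) z.2.2)).

Variables f g : X -> H.
Hypotheses (f_free : free_family f) (g_free : free_family g).

Lemma word_eval_transport (f' g' : X -> H) u (r : orbit_reps f') :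
    free_family f' ->
  word_eval g' (orbit_word f' (word_eval f' u * val r)%g) = word_eval g' u.
Proof.
move=> fr; rewrite (word_eval_free g' (orbit_word_eval fr u _)) word_eval_cat.
by rewrite (word_eval_free g' (orbit_word_rep fr (eqP (valP r)))) word_eval_nil mulg1.
Qed.

Lemma orbit_rep_in_eval (f' : X -> H) u (r : orbit_reps f') :
  orbit_rep_in f' (word_eval f' u * val r)%g = r.
Proof. by apply: val_inj; rewrite /= orbit_rep_eval; apply/eqP/(valP r). Qed.

Lemma seq_consK (T : Type) (s : nat -> T) : seq_cons (s 0) (fun i => s i.+1) = s.
Proof. by apply: funext => -[]. Qed.

Fact transportK : cancel (@transport f g) (@transport_inv f g).
Proof.
case=> x [s t]; rewrite /transport_inv /transport /=.
by rewrite word_eval_transport // orbit_rep_in_eval seq_consK -orbit_wordK.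
Qed.

Fact transport_invK : cancel (@transport_inv f g) (@transport f g).
Proof.
case=> x [s t]; rewrite /transport_inv /transport /=.
by rewrite word_eval_transport // orbit_rep_in_eval seq_consK -orbit_wordK.
Qed.

Fact translation_can x :
  cancel (fun z : carrier f g => ((x * z.1)%g, z.2)) (fun z => ((x^-1 * z.1)%g, z.2)).
Proof. by case=> y s; rewrite /= mulKg. Qed.
Fact translation_canV x :
  cancel (fun z : carrier f g => ((x^-1 * z.1)%g, z.2)) (fun z => ((x * z.1)%g, z.2)).
Proof. by case=> y s; rewrite /= mulVKg. Qed.

Definition translation x : bijection (carrier f g) :=
  Bijection (translation_can x) (translation_canV x).

Lemma translationM : {morph translation : x y / (x * y)%g}.
Proof. by move=> x y; apply: bijectionP => z; rewrite bijM /= mulgA. Qed.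

Lemma translation_inj : injective translation.
Proof.
move=> x y /(congr1 (fun s : bijection _ => (s (1%g, (fun=> orbit_rep_in f 1%g,
  fun=> orbit_rep_in g 1%g))).1)).
by rewrite /= !mulg1.
Qed.

Lemma transport_conj (t := Bijection transportK transport_invK) i :
  (t * translation (f i))%g = (translation (g i) * t)%g.
Proof.
apply: bijectionP => -[x s]; rewrite !bijM /= /transport /=; congr (_, (_, _)).
  rewrite -{1}(word_eval_gen f i).
  rewrite (word_eval_free g (orbit_word_eval f_free _ _)) word_eval_cat.
  by rewrite word_eval_gen mulgA.
congr seq_cons; apply: val_inj.
by rewrite /= -(word_eval_gen f i) orbit_rep_eval.
Qed.

End Transporter.

Section TwistGroup.
Variable n : int.
Notation G := (twist_group n).
Notation a := (twist_a n).
Notation b := (twist_b n).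
Notation w := (twist_w n).
Notation wn := (gexpz w n).

Lemma word_eval_tw_w (H : groupType) (f : bool -> H) :
  word_eval f tw_w = (f true * (f false)^-1 * (f true)^-1 * f false)%g.
Proof.
by rewrite /tw_w !word_eval_cat !word_eval_inv !word_eval_gen !mulgA.
Qed.

Lemma twist_relation : (a * wn = wn * b)%g.
Proof.
have gE : word_eval (pres_gen (@twist_rel n)) tw_w = w by rewrite word_eval_tw_w.
have := pres_rel [::] [::] (TwistRel n); rewrite !cats0 !cat0s => /pres_classP.
by rewrite -!pres_class_eval !word_eval_cat !word_eval_exp !word_eval_gen gE.
Qed.

Lemma twist_group_lift (H : groupType) (x y : H)
    (z := (x * y^-1 * x^-1 * y)%g) :
  (x * gexpz z n = gexpz z n * y)%g ->
  exists h : G -> H, [/\ {morph h : g1 g2 / (g1 * g2)%g}, h a = x & h b = y].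
Proof.
move=> xy; have [|h [[hM hg] _]] :=
    @presented_universal bool (@twist_rel n) H (pair_family x y).
  move=> r s [] {r s}; rewrite !word_eval_cat !word_eval_exp !word_eval_tw_w.
  by rewrite !word_eval_gen.
by exists h; split=> //; rewrite hg.
Qed.

Lemma twist_group_ind (P : G -> Prop) :
  P 1%g -> (forall g, P g -> P (a * g)%g) -> (forall g, P g -> P (a^-1 * g)%g) ->
  (forall g, P g -> P (b * g)%g) -> (forall g, P g -> P (b^-1 * g)%g) ->
  forall g, P g.
Proof.
move=> P1 Pa Pa' Pb Pb' g; rewrite -[g]pres_class_repr -pres_class_eval.
elim: (repr g) => [|[[] []] u IHu]; rewrite ?word_eval_nil ?word_eval_cons //=;
  [exact: Pa|exact: Pa'|exact: Pb|exact: Pb'].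
Qed.

Lemma twist_morph_eq (H : groupType) (h k : G -> H) :
    {morph h : x y / (x * y)%g} -> {morph k : x y / (x * y)%g} ->
  h a = k a -> h b = k b -> h =1 k.
Proof.
move=> hM kM ha hb; elim/twist_group_ind => [|g IH|g IH|g IH|g IH].
- by rewrite !morph_1g.
- by rewrite hM kM IH ha.
- by rewrite hM kM IH !morph_Vg // ha.
- by rewrite hM kM IH hb.
- by rewrite hM kM IH !morph_Vg // hb.
Qed.

(* The relations t V t^-1 = U and t (V^-n U^n V^(1-n)) t^-1 = V^-n present the
   twist group as an HNN extension of the free group on U and V. *)
Lemma hnn_relations (H : groupType) (t U V : H)
    (y := (gexpz V (- n) * gexpz U n * t)%g) :
    (t * V = U * t)%g ->
    (t * (gexpz V (- n) * gexpz U n * gexpz V (1 - n)) = gexpz V (- n) * t)%g ->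
  (t * y^-1 * t^-1 * y = V)%g /\ (t * gexpz V n = gexpz V n * y)%g.
Proof.
have: y = (gexpz V (- n) * gexpz U n * t)%g by [].
move: y => y yD tV tVU; have UE : U = (t * V * t^-1)%g by rewrite tV mulgK.
have Un : (gexpz U n * t = t * gexpz V n)%g by rewrite UE gexpzJ mulgVK.
split; last by rewrite yD !mulgA -gexpzD subrr mul1g Un.
apply: (mulgI (y * t^-1)%g); rewrite !mulgA mulgVK mulgV mul1g.
have -> : (t^-1 * y)%g = (gexpz V (- n) * gexpz U n * V)%g.
  apply: (mulgI t); rewrite mulVKg yD -mulgA Un mulgA -tVU -!mulgA -gexpzD.
  by rewrite addrNK.
by rewrite yD mulgK.
Qed.

(** The group acts on [carrier f g] with [a] as the transporter and [w] as translation by [V]; the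
    pair then acts by translations by [U] and [V^-n], nontrivial powers of two shears. *)
Lemma free_twist_fiber : n != 0 ->
  free_family (pair_family (a * w * a^-1)%g (gexpz w (- n))).
Proof.
move=> n0; pose U : bijection (int * int) := shear1.
pose V : bijection (int * int) := shear2.
pose f := pair_family V (gexpz V (- n) * gexpz U n * gexpz V (1 - n))%g.
pose g := pair_family U (gexpz V (- n)).
have ff : free_family f.
  by apply/free_pair_nielsen/free_pair_swap; apply: (@free_shears n 1).
have gf : free_family g.
  by apply: (@free_shears 1 (- n)); rewrite ?oppr_eq0.
pose t : bijection (carrier f g) :=
  Bijection (transportK gf) (transport_invK ff).
pose L := @translation _ _ f g.
have LM : {morph L : x y / (x * y)%g} := @translationM _ _ _ _.
have tV : (t * L V = L U * t)%g := transport_conj ff gf true.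
have tVU := transport_conj ff gf false; rewrite -/L -/t /= in tVU.
rewrite !LM !(morph_gexpz LM) in tVU.
have [] := hnn_relations tV tVU; set y := (_ * _ * t)%g => wV rel.
have [|h [hM ha hb]] := @twist_group_lift _ t y; first by rewrite wV.
have hw : h w = L V by rewrite /twist_w !hM !(morph_Vg hM) ha hb wV.
apply: (free_family_morph hM).
rewrite (_ : (fun b => _) = fun b => L (g b)).
  exact: free_family_inj LM (@translation_inj _ _ _ _) gf.
apply: funext => -[] /=; last by rewrite (morph_gexpz hM) hw (morph_gexpz LM).
by rewrite hM (hM a) (morph_Vg hM) ha hw tV mulgK.
Qed.

End TwistGroup.

(** * Modules, extensions and the relator *)

Section AdditiveFunctions.
Variables (U W : zmodType) (h : U -> W).
Hypothesis hD : {morph h : x y / x + y}.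

Lemma morph_add0 : h 0 = 0.
Proof. by apply: (addrI (h 0)); rewrite -hD !addr0. Qed.

Lemma morph_addN x : h (- x) = - h x.
Proof. by apply: (addrI (h x)); rewrite -hD !subrr morph_add0. Qed.

Lemma morph_addMz x (k : int) : h (x *~ k) = h x *~ k.
Proof.
elim/int_rect: k => [|k IHk|k IHk]; first by rewrite !mulr0z morph_add0.
  by rewrite intS !mulrzDr hD IHk.
by rewrite intS opprD !mulrzDr hD IHk !mulrNz !mulr1z morph_addN.
Qed.

End AdditiveFunctions.

Section Modules.
Variables (G : groupType) (M : zmodType).
Implicit Types (act : G -> M -> M) (g h : G) (m : M).

Definition is_gmodule act : Prop :=
  [/\ forall g, {morph act g : x y / x + y}, forall m, act 1%g m = m
    & forall g h m, act (g * h)%g m = act g (act h m)].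

Variable act : G -> M -> M.
Hypothesis actP : is_gmodule act.

Lemma actD g : {morph act g : x y / x + y}. Proof. by case: actP. Qed.
Lemma act1 m : act 1%g m = m. Proof. by case: actP. Qed.
Lemma actM g h m : act (g * h)%g m = act g (act h m). Proof. by case: actP. Qed.
Lemma act0 g : act g 0 = 0. Proof. exact: morph_add0 (actD g). Qed.
Lemma actN g : {morph act g : x / - x}.
Proof. by move=> x; apply: morph_addN (actD g) x. Qed.
Lemma actB g : {morph act g : x y / x - y}.
Proof. by move=> x y; rewrite actD actN. Qed.
Lemma actK g m : act g^-1%g (act g m) = m. Proof. by rewrite -actM mulVg act1. Qed.
Lemma actVK g m : act g (act g^-1%g m) = m. Proof. by rewrite -actM mulgV act1. Qed.

End Modules.

Definition coind (G : groupType) (M : zmodType) (g : G) (f : G -> M) :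
    G -> M := fun x => f (x * g)%g.

Lemma coind_gmodule (G : groupType) (M : zmodType) : is_gmodule (@coind G M).
Proof.
split=> [g f h|f|g h f]; apply: funext => x; rewrite /coind //=.
  by rewrite mulg1.
by rewrite mulgA.
Qed.

Section Extensions.
Variables (G E : groupType) (M : zmodType) (act : G -> M -> M).
Variables (proj : E -> G) (inj : M -> E).
Hypothesis projM : {morph proj : x y / (x * y)%g}.
Hypothesis injD : {morph inj : x y / x + y >-> (x * y)%g}.
Hypothesis inj_proj : forall m, proj (inj m) = 1%g.
Hypothesis inj_comm : forall e m, (e * inj m = inj (act (proj e) m) * e)%g.

Lemma inj_shift e m f : (e * (inj m * f) = inj (act (proj e) m) * (e * f))%g.
Proof. by rewrite !mulgA inj_comm. Qed.

Lemma inj_merge m m' f : (inj m * (inj m' * f) = inj (m + m') * f)%g.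
Proof. by rewrite mulgA injD. Qed.

Lemma injN m : inj (- m) = (inj m)^-1%g.
Proof.
apply: (mulgI (inj m)); rewrite mulgV -injD subrr.
by apply: (mulgI (inj 0)); rewrite -injD addr0 mulg1.
Qed.

(* [p] and [q] change the lifts x, y of a, b; by the first equation of
   [fox_system] the lift of w is merely conjugated by m. *)
Definition fox_system (k : int) (a b : G) (p q m phi : M)
    (w := (a * b^-1 * a^-1 * b)%g) : Prop :=
  p + act a (act b^-1%g (act a^-1%g (q - p) - q)) = act w m - m /\
  p + act a (act (gexpz w k) m - m) - (act (gexpz w k) m - m) - act (gexpz w k) q = phi.

(** The first Fox equation makes [z'] the conjugate of [z] by [inj m], so its k-th power is that of
    [z] shifted by (w^k - 1) m; the second equation makes the total change cancel the defect
    [kappa]. *)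
Lemma modify_lifts k (x y z z' : E) p q m kappa
    (x' := (inj p * x)%g) (y' := (inj q * y)%g) :
    z = (x * y^-1 * x^-1 * y)%g -> z' = (x' * y'^-1 * x'^-1 * y')%g ->
    fox_system k (proj x) (proj y) p q m (- kappa) ->
    (x * gexpz z k = inj kappa * (gexpz z k * y))%g ->
  (x' * gexpz z' k = gexpz z' k * y')%g.
Proof.
have projV := morph_Vg projM.
move=> zE z'D []; set w := (proj x * _ * _ * _)%g => eqw eqr xz.
have zw : proj z = w by rewrite zE !projM !projV.
have z'E : z' = ((inj m)^-1 * z * inj m)%g.
  rewrite z'D /x' /y' !invgM -!injN -!mulgA inj_merge (inj_shift x^-1) inj_merge.
  rewrite (inj_shift y^-1) (inj_shift x) inj_merge !projV.
  rewrite [- p + q]addrC [- q + _]addrC eqw inj_comm zw inj_merge.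
  by rewrite [- m + _]addrC zE !mulgA.
have zkE : gexpz z' k = (inj (act (gexpz w k) m - m) * gexpz z k)%g.
  have := gexpzJ z (inj m)^-1%g k; rewrite invgK -z'E => ->.
  rewrite -injN -mulgA inj_comm.
  by rewrite (morph_gexpz projM) zw inj_merge addrC.
rewrite zkE /x' /y' -!mulgA inj_shift inj_merge xz inj_merge.
rewrite inj_shift inj_merge (morph_gexpz projM) zw; congr (inj _ * _)%g.
move: eqr; set P := p + _; set A := _ - m; set B := act _ q => eqr.
by rewrite -[kappa]opprK -eqr !opprB addrCA [P + _]addrC subrK addrC.
Qed.

End Extensions.

Section RelatorOnto.
Variable n : int.
Notation G := (twist_group n).
Notation a := (twist_a n).
Notation b := (twist_b n).
Notation w := (twist_w n).
Notation wn := (gexpz w n).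

(* In degree 2 the dual of the Fox complex of the presentation is onto. *)
Definition relator_onto (M : zmodType) (act : G -> M -> M) : Prop :=
  forall phi, exists p q m, fox_system act n a b p q m phi.

(** Arbitrary lifts of the generators satisfy the relation up to some [kappa] in [M]; [relator_onto]
    provides the modification that removes it, and the modified lifts define the section. *)
Lemma extension_splits (M : zmodType) (act : G -> M -> M) (E : groupType)
    (proj : E -> G) (inj : M -> E) :
    is_gmodule act -> relator_onto act ->
    {morph proj : x y / (x * y)%g} -> {morph inj : x y / x + y >-> (x * y)%g} ->
    (forall m, proj (inj m) = 1%g) ->
    (forall e m, (e * inj m = inj (act (proj e) m) * e)%g) ->
    (forall e, proj e = 1%g -> exists m, e = inj m) ->
    (forall g, exists e, proj e = g) ->
  exists s : G -> E, {morph s : x y / (x * y)%g} /\ forall g, proj (s g) = g.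
Proof.
move=> actP onto projM injD inj_proj inj_comm proj_ker proj_surj.
have projV := morph_Vg projM.
have [[x xa] [y yb]] := (proj_surj a, proj_surj b).
pose z := (x * y^-1 * x^-1 * y)%g.
have zw : proj z = w by rewrite /z !projM !projV xa yb.
have [kappa xz] : exists kappa, (x * gexpz z n = inj kappa * (gexpz z n * y))%g.
  have [|kappa e] := proj_ker (x * gexpz z n * (gexpz z n * y)^-1)%g.
    by rewrite !projM projV projM (morph_gexpz projM) xa yb zw twist_relation mulgV.
  by exists kappa; rewrite -e mulgVK.
have [p [q [m sys]]] := onto (- kappa).
rewrite -xa -yb in sys.
have rel := modify_lifts projM injD inj_comm (erefl z) erefl sys xz.
have [s [sM sa sb]] := twist_group_lift rel.
exists s; split=> //.
apply: (@twist_morph_eq n G (fun g => proj (s g)) id) => //.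
- by move=> g h; rewrite sM projM.
- by rewrite sa projM inj_proj mul1g xa.
- by rewrite sb projM inj_proj mul1g yb.
Qed.

Lemma relator_onto_quotient (M N : zmodType) (actM : G -> M -> M)
    (actN : G -> N -> N) (f : M -> N) :
    is_gmodule actM -> is_gmodule actN ->
    {morph f : x y / x + y} -> (forall g m, f (actM g m) = actN g (f m)) ->
    (forall y, exists x, f x = y) ->
  relator_onto actM -> relator_onto actN.
Proof.
move=> aM aN fD fact fsurj onto phi; have [psi <-] := fsurj phi.
have fN : {morph f : x / - x} := morph_addN fD.
have [p [q [m [e1 e2]]]] := onto psi; exists (f p), (f q), (f m); split.
  by have := congr1 f e1; rewrite !(fD, fN, fact).
by rewrite -e2 !(fD, fN, fact).
Qed.

(** For p = theta and m = 0 the second equation forces q = w^-n (theta - phi). If theta is invariant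
    under u, the first one only prescribes theta (x v) - theta x, which can be met because u and v
    form a free family. *)
Lemma coind_relator_onto (M : zmodType) : n != 0 -> relator_onto (@coind G M).
Proof.
move=> n0 phi; set u := (a * w * a^-1)%g; set v := gexpz w (- n).
have [theta th] := free_family_solve (free_twist_fiber n0)
  (pair_family (fun=> 0) (fun x => phi (x * v)%g - phi (x * a * v)%g)).
have thu x : theta (x * u)%g = theta x.
  by apply/eqP; rewrite -subr_eq0; apply/eqP/(th true x).
have thv x : theta (x * v)%g = theta x + (phi (x * v)%g - phi (x * a * v)%g).
  by have := th false x; rewrite /= => <-; rewrite addrC subrK.
have thun x k : theta (x * gexpz u k)%g = theta x.
  elim/int_rect: k => [|k IHk|k IHk]; first by rewrite mulg1.
    by rewrite intS addrC gexpzD mulgA -[gexpz u 1]/u thu.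
  by rewrite intS opprD addrC gexpzD mulgA -(thu (_ * gexpz u (-1))%g) mulgVK.
(* Together with invariance under u, this identifies theta (y a b a^-1) with theta (y a v). *)
have ab : (a * b * a^-1 = a * v * gexpz u n)%g.
  have -> : b = (v * (a * wn))%g by rewrite twist_relation mulgA -gexpzD addNr mul1g.
  by rewrite /u gexpzJ !mulgA.
(* With these values the lift of w is unchanged, whence m = 0. *)
exists theta, (fun x => theta (x * v)%g - phi (x * v)%g), 0.
have c0 g : coind g 0 = 0 :> (G -> M) by [].
split; last first.
  rewrite !c0 !subr0 addr0; apply: funext => x; rewrite addrfctE opprfctE /coind.
  by rewrite -mulgA -gexpzD subrr mulg1 opprB addrC subrK.
rewrite c0 subr0; apply: funext => x.
rewrite !(addrfctE, opprfctE) /coind -!mulgA !mulgA.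
set y := (x * a * b^-1 * a^-1)%g.
have -> : (x * a * b^-1)%g = (y * a)%g by rewrite mulgVK.
have -> : theta x = theta (y * a * v)%g.
  rewrite -(thun (y * a * v)%g n) -!mulgA (mulgA a v) -ab; congr theta.
  by rewrite /y !mulgA !mulgVK mulgK.
rewrite (thv y).
rewrite [_ - phi _ - theta y]addrAC [theta y + _]addrC addrK.
rewrite [_ - _ - phi (y * v)%g]addrAC subrr sub0r opprB addKr subrr.
by [].
Qed.

End RelatorOnto.

(** * Bar cohomology *)

Section Faces.
Variable G : groupType.

Lemma bar_face0 k (x : G) (t : k.-tuple G) :
  bar_face ord0 [tuple of x :: t] = t.
Proof. by apply: eq_from_tnth => j; rewrite tnth_mktuple /= tnthS. Qed.

Lemma bar_faceS k (x : G) (t : k.+1.-tuple G) (i : 'I_k.+2) :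
  bar_face (lift ord0 i) [tuple of x :: t] =
  [tuple of (if i == ord0 then x * thead t else x)%g :: bar_face i t].
Proof.
have widenS m (j : 'I_m) :
    widen_ord (leqnSn m.+1) (lift ord0 j) = lift ord0 (widen_ord (leqnSn m) j).
  exact: val_inj.
apply: eq_from_tnth => j; rewrite tnth_mktuple.
case: (unliftP ord0 j) => [j' ->|->] /=.
  by rewrite widenS !tnthS tnth_mktuple /bump !leq0n !add1n ltnS eqSS.
have -> : widen_ord (leqnSn k.+1) ord0 = ord0 by apply: val_inj.
rewrite !tnth0 tnthS /bump leq0n add1n.
by rewrite -(inj_eq val_inj); case: i => -[|i] //= _; rewrite tnth0.
Qed.

End Faces.

Lemma mulrz_fun (T : Type) (M : zmodType) (f : T -> M) (k : int) x :
  (f *~ k) x = f x *~ k.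
Proof. by apply: (@morph_addMz _ _ (fun g : T -> M => g x)). Qed.

Section Cochains.
Variable G : groupType.

Definition cobound (M : zmodType) (act : G -> M -> M) (k : nat)
    (f : k.-tuple G -> M) (t : k.+1.-tuple G) : M :=
  \sum_(i < k.+2) (if i == ord0 then act (thead t) (f (bar_face i t))
                   else f (bar_face i t)) *~ (-1) ^+ i.

(** The index is shifted: this is vanishing of cohomology in degree k + 1. *)
Definition coh_vanishes (M : zmodType) (act : G -> M -> M) (k : nat) : Prop :=
  forall f : k.+1.-tuple G -> M, (forall t, cobound act f t = 0) ->
  exists e : k.-tuple G -> M, forall t, cobound act e t = f t.

Definition slice (M : zmodType) k (f : k.+1.-tuple G -> M) (t : k.-tuple G) : G -> M :=
  fun x => f [tuple of x :: t].

Definition orbit_map (M : zmodType) (act : G -> M -> M) (m : M) : G -> M :=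
  fun x => act x m.

(** Moving the first argument into the coefficients lowers the degree by one; this recursion drives
    the inductions on the degree. *)
Lemma cobound_cons (M : zmodType) (act : G -> M -> M) k (f : k.+1.-tuple G -> M)
    (x : G) (t : k.+1.-tuple G) :
  cobound act f [tuple of x :: t] =
  act x (f t) - cobound (@coind G M) (slice f) t x.
Proof.
rewrite /cobound big_ord_recl /= bar_face0 theadE expr0 mulr1z; congr (_ + _).
rewrite fct_sumE -sumrN; apply: eq_bigr => i _.
rewrite mulrz_fun bar_faceS /= exprS mulN1r mulrNz; congr (- (_ *~ _)).
by case: eqP.
Qed.

Lemma cobound_nil (M : zmodType) (act : G -> M -> M) (f : 0.-tuple G -> M)
    (x : G) (s : 0.-tuple G) :
  cobound act f [tuple of x :: s] = act x (f s) - f s.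
Proof.
rewrite /cobound !big_ord_recl big_ord0 /= addr0 expr0 mulr1z expr1 mulrN1z.
by rewrite theadE (tuple0 s) !(tuple0 (bar_face _ _)).
Qed.

Lemma cobound_eq (M : zmodType) (act : G -> M -> M) k (f g : k.-tuple G -> M) t :
  f =1 g -> cobound act f t = cobound act g t.
Proof. by move=> /funext ->. Qed.

Lemma cobound_morph (M N : zmodType) (actM : G -> M -> M) (actN : G -> N -> N)
    (phi : M -> N) k (f : k.-tuple G -> M) t :
    {morph phi : x y / x + y} -> (forall g m, phi (actM g m) = actN g (phi m)) ->
  cobound actN (fun s => phi (f s)) t = phi (cobound actM f t).
Proof.
move=> phiD phiA.
rewrite /cobound (big_morph phi phiD (morph_add0 phiD)); apply: eq_bigr => i _.
by rewrite (morph_addMz phiD); case: ifP => _; rewrite ?phiA.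
Qed.

Lemma coboundB (M : zmodType) (act : G -> M -> M) k (f g : k.-tuple G -> M) t :
    is_gmodule act ->
  cobound act (fun s => f s - g s) t = cobound act f t - cobound act g t.
Proof.
move=> actP; rewrite /cobound -sumrB; apply: eq_bigr => i _.
by case: ifP => _; rewrite ?(actB actP) mulrzBl.
Qed.

Lemma cobound_orbit_map (M : zmodType) (act : G -> M -> M) k (f : k.-tuple G -> M) t x :
    is_gmodule act ->
  cobound (@coind G M) (fun s => orbit_map act (f s)) t x = act x (cobound act f t).
Proof.
move=> actP; rewrite (@cobound_morph _ _ act _ (orbit_map act)) //.
  by move=> m m'; apply: funext => y; rewrite /orbit_map (actD actP).
by move=> g m; apply: funext => y; rewrite /orbit_map /coind (actM actP).
Qed.

(** Induction over all modules at once: the hypothesis is applied to the coinduced module, and the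
    two terms that remain are both [act x (cobound act f t)]. *)
Lemma cobound_cobound k (M : zmodType) (act : G -> M -> M) (f : k.-tuple G -> M) t :
  is_gmodule act -> cobound act (cobound act f) t = 0.
Proof.
elim: k M act f t => [|k IHk] M act f t actP; case/tupleP: t => x t.
  case/tupleP: t => y t; rewrite cobound_cons !cobound_nil /coind /slice.
  rewrite addrfctE opprfctE !cobound_nil (tuple0 t).
  rewrite (actB actP) -(actM actP) !opprB.
  by rewrite addrA subrK subrr.
rewrite cobound_cons.
rewrite (@cobound_eq _ _ _ _ (fun s => orbit_map act (f s) -
  cobound (@coind G M) (slice f) s)); last first.
  by move=> s; apply: funext => y; rewrite /slice cobound_cons.
have cP := coind_gmodule G M.
rewrite (coboundB _ _ _ cP) (IHk _ _ _ _ cP) subr0 cobound_orbit_map //.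
by rewrite subrr.
Qed.

End Cochains.

Section DimensionShift.
Variables (G : groupType) (M : zmodType).

Definition null_at_1 : {pred G -> M} := [pred f : G -> M | f 1%g == 0].

Fact null_at_1_closed : zmod_closed null_at_1.
Proof.
split=> [|f g]; rewrite !inE //= => /eqP f1 /eqP g1.
by rewrite addrfctE opprfctE f1 g1 subrr.
Qed.
HB.instance Definition _ :=
  GRing.isZmodClosed.Build (G -> M) null_at_1 null_at_1_closed.

(* Stands for the quotient of the coinduced module [G -> M] by the image of
   [orbit_map], each class being represented by its member vanishing at 1. *)
Record normalized := Normalized {nval : G -> M; _ : nval \in null_at_1}.

HB.instance Definition _ := [isSub for nval].
HB.instance Definition _ := [Choice of normalized by <:].
HB.instance Definition _ := [SubChoice_isSubZmodule of normalized by <:].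

Variable act : G -> M -> M.
Hypothesis actP : is_gmodule act.

Fact normalize_subproof (f : G -> M) : (fun x => f x - act x (f 1%g)) \in null_at_1.
Proof. by rewrite inE /= (act1 actP) subrr. Qed.
Definition normalize f := Normalized (normalize_subproof f).

Definition quot_act (g : G) (f : normalized) : normalized :=
  normalize (coind g (nval f)).

Lemma nval1 f : nval f 1%g = 0. Proof. by case: f => f /= /eqP. Qed.

Lemma normalizedP (f g : normalized) : nval f =1 nval g -> f = g.
Proof. by move=> /funext fg; apply: val_inj. Qed.

Lemma nvalK : cancel nval normalize.
Proof. by move=> f; apply: normalizedP => x /=; rewrite nval1 (act0 actP) subr0. Qed.

Lemma normalizeD : {morph normalize : f g / f + g}.
Proof.
move=> f g; apply: normalizedP => x /=.
by rewrite !addrfctE (actD actP) opprD addrACA.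
Qed.

Lemma normalize_act g f : normalize (coind g f) = quot_act g (normalize f).
Proof.
apply: normalizedP => x; rewrite /= /coind !mul1g (actB actP) -!(actM actP).
by rewrite opprB addrA subrK.
Qed.

Lemma quot_gmodule : is_gmodule quot_act.
Proof.
have [cD c1 cM] := coind_gmodule G M.
split=> [g f h|f|g h f].
- by rewrite /quot_act -normalizeD -cD.
- by rewrite /quot_act c1 nvalK.
- by rewrite -[f]nvalK -!normalize_act cM.
Qed.

(** By [sf] the slices of a cocycle [f] have the orbit maps of [f] as coboundary, so they form a
    cocycle in the quotient. Subtracting the coboundary of a lift of its primitive leaves [d] with
    values in the image of [M], and evaluation at 1 yields a primitive of [f]. *)
Lemma coh_vanishes_shift k : coh_vanishes quot_act k -> coh_vanishes act k.+1.
Proof.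
move=> van f f0.
have cP := coind_gmodule G M.
have sf t x : cobound (@coind G M) (slice f) t x = act x (f t).
  by apply/esym/eqP; rewrite -subr_eq0 -cobound_cons f0.
have [|e eE] := van (fun t => normalize (slice f t)).
  move=> t; rewrite (cobound_morph _ _ normalizeD normalize_act).
  by apply: normalizedP => x /=; rewrite !sf (act1 actP) subrr.
pose d t := slice f t - cobound (@coind G M) (fun s => nval (e s)) t.
have dE t x : d t x = act x (d t 1%g).
  have dD : slice f t = d t + cobound (@coind G M) (fun s => nval (e s)) t.
    by rewrite /d subrK.
  have : normalize (d t) = 0.
    apply: (addIr (normalize (cobound (@coind G M) (fun s => nval (e s)) t))).
    rewrite -normalizeD -dD -(cobound_morph _ _ normalizeD normalize_act).
    rewrite add0r -eE; apply: cobound_eq => s; exact/esym/nvalK.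
  by move=> /(congr1 (fun f => nval f x)) /= /eqP; rewrite subr_eq0 => /eqP.
exists (fun t => d t 1%g) => t.
rewrite -[LHS](act1 actP) -cobound_orbit_map //.
rewrite -[RHS](act1 actP) -sf.
rewrite (@cobound_eq _ _ _ _ _ d); last first.
  by move=> s; apply: funext => x; rewrite /orbit_map -dE.
rewrite (coboundB _ _ _ cP) (cobound_cobound _ _ cP).
by rewrite subr0.
Qed.

End DimensionShift.

Section CocycleExtension.
Variables (G : groupType) (M : zmodType) (act : G -> M -> M) (c : G -> G -> M).

Definition is_cocycle2 : Prop :=
  forall x y z, act x (c y z) + c x (y * z)%g = c (x * y)%g z + c x y.

Hypotheses (actP : is_gmodule act) (cP : is_cocycle2).

(** Both proofs are parameters of the type, so that the group structure attached to it can depend on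
    them. *)
Definition cocycle_ext & is_gmodule act & is_cocycle2 : Type := (M * G)%type.
Local Notation E := (cocycle_ext actP cP).

HB.instance Definition _ := Choice.copy E (M * G)%type.

Definition ext_mul (e f : E) : E := (e.1 + act e.2 f.1 + c e.2 f.2, (e.2 * f.2)%g).
(** As [c] may be nonzero at (1, 1), this value corrects the unit, the inverse and the embedding
    [ext_inj]. *)
Definition ext_one : E := (- c 1%g 1%g, 1%g).
Definition ext_inv (e : E) : E :=
  (- act e.2^-1%g e.1 - c e.2^-1%g e.2 - c 1%g 1%g, e.2^-1%g).

Lemma cocycle1g x : c 1%g x = c 1%g 1%g.
Proof.
have := cP 1%g 1%g x; rewrite !mul1g (act1 actP) => /addrI e.
by rewrite e.
Qed.

Lemma cocycleg1 x : c x 1%g = act x (c 1%g 1%g).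
Proof. by have := cP x 1%g 1%g; rewrite !mulg1 => /addIr. Qed.

Fact ext_mulA : associative ext_mul.
Proof.
move=> e f g; rewrite /ext_mul /= mulgA; congr pair.
rewrite !(actD actP) -(actM actP) -!addrA; do 2!congr (_ + _).
by rewrite [RHS]addrCA; congr (_ + _); rewrite cP addrC.
Qed.

Fact ext_mul1 : left_id ext_one ext_mul.
Proof.
case=> m g; rewrite /ext_mul /= mul1g (act1 actP) (cocycle1g g).
by rewrite addrAC addNr add0r.
Qed.

Fact ext_mulg1 : right_id ext_one ext_mul.
Proof.
by case=> m g; rewrite /ext_mul /= mulg1 (cocycleg1 g) (actN actP) subrK.
Qed.

Fact ext_mulV : left_inverse ext_one ext_inv ext_mul.
Proof.
case=> m g; rewrite /ext_mul /ext_inv /ext_one /= mulVg; congr pair.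
by rewrite addrAC [_ - _ - c 1%g 1%g]addrAC subrK addrAC addNr add0r.
Qed.

Fact ext_mulgV : right_inverse ext_one ext_inv ext_mul.
Proof.
case=> m g; rewrite /ext_mul /ext_inv /ext_one /= mulgV; congr pair.
have := cP g g^-1%g g; rewrite mulVg mulgV (cocycle1g g) (cocycleg1 g) => e.
rewrite !(actD actP) !(actN actP) (actVK actP) !addrA subrr add0r.
by rewrite -opprD e opprD subrK.
Qed.

HB.instance Definition _ := isGroup.Build E
  ext_mulA ext_mul1 ext_mulg1 ext_mulV ext_mulgV.

Definition ext_proj (e : E) : G := e.2.
Definition ext_inj (m : M) : E := (m - c 1%g 1%g, 1%g).

Lemma ext_projM : {morph ext_proj : x y / (x * y)%g}. Proof. by []. Qed.

Lemma ext_injD : {morph ext_inj : x y / x + y >-> (x * y)%g}.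
Proof.
move=> x y; congr pair; last by rewrite mulg1.
by rewrite /= (act1 actP) addrA subrK addrAC.
Qed.

Lemma ext_inj_comm (e : E) m : (e * ext_inj m = ext_inj (act (ext_proj e) m) * e)%g.
Proof.
case: e => x g; congr pair; last by rewrite /= mulg1 mul1g.
rewrite /= (act1 actP) (actB actP) (cocycleg1 g) (cocycle1g g) /ext_proj /=.
by rewrite addrA subrK addrAC subrK addrC.
Qed.

Lemma ext_proj_ker (e : E) : ext_proj e = 1%g -> exists m, e = ext_inj m.
Proof.
case: e => x g; rewrite /ext_proj /= => ->; exists (x + c 1%g 1%g).
by rewrite /ext_inj addrK.
Qed.

End CocycleExtension.

Section TwistCohomology.
Variable n : int.
Notation G := (twist_group n).

(** A 2-cocycle defines an extension by [M], and a multiplicative section of it exhibits the cocycle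
    as a coboundary. *)
Lemma coh_vanishes1 (M : zmodType) (act : G -> M -> M) :
  is_gmodule act -> relator_onto act -> coh_vanishes act 1.
Proof.
move=> actP onto f f0.
pose c (x y : G) := f [tuple of x :: [tuple of y :: [tuple]]].
have cP : is_cocycle2 act c.
  move=> x y z; have := f0 [tuple of x :: [tuple of y :: [tuple of z :: [tuple]]]].
  rewrite cobound_cons cobound_cons addrfctE opprfctE cobound_nil.
  rewrite addrfctE opprfctE /coind /slice -/(c _ _) -/(c _ _).
  move/eqP; rewrite subr_eq0 => /eqP e.
  by rewrite {1}/c e opprB addrA subrK.
have [s [sM sK]] := extension_splits actP onto (@ext_projM _ _ _ _ actP cP)
  (@ext_injD _ _ _ _ actP cP) (fun=> erefl) (@ext_inj_comm _ _ _ _ actP cP)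
  (@ext_proj_ker _ _ _ _ actP cP) (fun g => ex_intro _ (0, g) erefl).
(* Multiplicativity reads s(xy).1 = s(x).1 + x s(y).1 + c(x, y), whence the sign. *)
exists (fun t => - (s (thead t)).1) => t.
case/tupleP: t => x t; case/tupleP: t => y t; rewrite (tuple0 t).
rewrite cobound_cons cobound_nil /coind /slice /= !theadE.
rewrite addrfctE opprfctE /= !theadE sM /=.
rewrite -![(s _).2]/(ext_proj (s _)) !sK (actN actP) opprB opprK -addrA !addKr.
by [].
Qed.

(** The base case is degree 3: it shifts to degree 2 of a quotient of the coinduced module, which
    inherits [relator_onto]. *)
Lemma coh_vanishes_high (M : zmodType) (act : G -> M -> M) k :
  n != 0 -> is_gmodule act -> coh_vanishes act k.+2.
Proof.
move=> n0; elim: k M act => [|k IHk] M act actP.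
  apply: coh_vanishes_shift => //; apply: coh_vanishes1; first exact: quot_gmodule.
  apply: (@relator_onto_quotient _ _ _ _ _ (normalize actP)).
  - exact: coind_gmodule.
  - exact: quot_gmodule.
  - exact: normalizeD.
  - exact: normalize_act.
  - by move=> f; exists (nval f); apply: nvalK.
  - exact: coind_relator_onto.
by apply: coh_vanishes_shift => //; apply/IHk/quot_gmodule.
Qed.

(** In the split extension given by the zero cocycle, the first component of a multiplicative
    section is a crossed homomorphism; [modify_lifts] produces the section from the lifts (0, a) and
    (0, b). *)
Lemma crossed_hom_extension (M : zmodType) (act : G -> M -> M) p q m :
    is_gmodule act -> fox_system act n (twist_a n) (twist_b n) p q m 0 ->
  exists z : G -> M, [/\ forall g h, z (g * h)%g = z g + act g (z h),
    z (twist_a n) = p & z (twist_b n) = q].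
Proof.
move=> actP sys; have cP : is_cocycle2 act (fun _ _ => 0).
  by move=> x y z; rewrite (act0 actP).
pose E := cocycle_ext actP cP.
pose a' : E := (0, twist_a n); pose b' : E := (0, twist_b n).
have sys' : fox_system act n 
      (@ext_proj _ _ _ _ actP cP a') (@ext_proj _ _ _ _ actP cP b') p q m (- 0).
  by rewrite oppr0.
have emb0 : {morph (fun g : G => (0, g) : E) : g h / (g * h)%g}.
  by move=> g h; congr pair; rewrite /= (act0 actP) !addr0.
pose w' : E := (0, twist_w n).
have w'E : w' = (a' * b'^-1 * a'^-1 * b')%g.
  by rewrite -!(morph_Vg emb0) -!emb0.
have w'n : gexpz w' n = (0, gexpz (twist_w n) n) by rewrite -(morph_gexpz emb0).
have rel : (a' * gexpz w' n = ext_inj actP cP 0 * (gexpz w' n * b'))%g.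
  rewrite w'n -!emb0 -twist_relation; congr pair; last by rewrite /= mul1g.
  by rewrite /= (act0 actP) subrr !addr0.
have := modify_lifts (@ext_projM _ _ _ _ actP cP) (@ext_injD _ _ _ _ actP cP)
  (@ext_inj_comm _ _ _ _ actP cP) w'E erefl sys' rel.
set x := (_ * a')%g; set y := (_ * b')%g => /twist_group_lift [s [sM sa sb]].
have s2 g : (s g).2 = g.
  apply: (@twist_morph_eq n G (fun g => (s g).2) id) => //.
  - by move=> g1 g2; rewrite sM.
  - by rewrite sa /= mul1g.
  - by rewrite sb /= mul1g.
exists (fun g => (s g).1); split=> [g h||].
- by rewrite sM /= s2 addr0.
- by rewrite sa /= (act0 actP) subr0 !addr0.
- by rewrite sb /= (act0 actP) subr0 !addr0.
Qed.

End TwistCohomology.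

(** * Homology from cohomology *)

Section LinearExtension.
Variables (K : choiceType) (V Q : zmodType) (F : K -> V -> Q).
Hypothesis FD : forall k, {morph F k : x y / x + y}.

Definition linear_ext (c : {malg V[K]}) : Q := \sum_(k <- msupp c) F k c@_k.

Lemma linear_extEw (d : {fset K}) c : (msupp c `<=` d)%fset ->
  linear_ext c = \sum_(k <- d) F k c@_k.
Proof.
move=> le; rewrite [LHS](big_fset_incl _ le) => //= x xd /mcoeff_outdom ->.
exact: morph_add0.
Qed.

Lemma linear_extD : {morph linear_ext : x y / x + y}.
Proof.
move=> c d; pose E := (msupp c `|` msupp d)%fset.
rewrite !(@linear_extEw E) ?fsubsetUl ?fsubsetUr ?msuppD_le // -big_split.
by apply: eq_bigr => k _; rewrite mcoeffD FD.
Qed.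

Lemma linear_extU k v : linear_ext << v *g k >> = F k v.
Proof. by rewrite (linear_extEw msuppU_le) big_seq_fset1 mcoeffUU. Qed.

End LinearExtension.

Section AdditiveMaps.
Variables V Q : zmodType.

Definition additive_pred : {pred V -> Q} :=
  [pred f : V -> Q | `[< {morph f : x y / x + y} >]].

Fact additive_pred_closed : zmod_closed additive_pred.
Proof.
split=> [|f g]; rewrite !inE /=.
  by apply/asboolP => x y; rewrite addr0.
move=> /asboolP fD /asboolP gD; apply/asboolP => x y.
by rewrite !addrfctE !opprfctE fD gD opprD addrACA.
Qed.
HB.instance Definition _ :=
  GRing.isZmodClosed.Build (V -> Q) additive_pred additive_pred_closed.

(** Maps are only additive, since the targets are abelian groups of chains modulo boundaries. *)
Record hom := Hom {hom_fun :> V -> Q; _ : hom_fun \in additive_pred}.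

HB.instance Definition _ := [isSub for hom_fun].
HB.instance Definition _ := [Choice of hom by <:].
HB.instance Definition _ := [SubChoice_isSubZmodule of hom by <:].

Lemma homD (f : hom) : {morph f : x y / x + y}.
Proof. by case: f => f /= /asboolP. Qed.

Lemma homP (f g : hom) : f =1 g -> f = g.
Proof. by move=> /funext fg; apply: val_inj. Qed.

Definition mk_hom (f : V -> Q) (fD : {morph f : x y / x + y}) : hom :=
  @Hom f (asboolT fD).

Lemma hom_evalD x : {morph (fun f : hom => f x) : f g / f + g}. Proof. by []. Qed.
Lemma hom_eval0 x : (0 : hom) x = 0. Proof. by []. Qed.

Lemma hom_evalMz x (f : hom) (k : int) : (f *~ k) x = f x *~ k.
Proof. by apply: (@morph_addMz _ _ (fun g : hom => g x)). Qed.

Lemma hom_eval_sum x (I : Type) (r : seq I) (f : I -> hom) :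
  (\sum_(i <- r) f i) x = \sum_(i <- r) f i x.
Proof. by apply: (big_morph (fun f : hom => f x)). Qed.

End AdditiveMaps.

Section Duality.
Variables (G : groupType) (F : fieldType) (m : nat).
Variable rho : {multiplicative G -> 'SL_m.+1[F]}.
Notation V := 'cV[F]_m.+1.

Fact hom_act_subproof (Q : zmodType) g (f : hom V Q) :
  {morph (fun v => f ((rho g)^-1%g *m v)) : x y / x + y}.
Proof. by move=> x y; rewrite mulmxDr homD. Qed.

Definition hom_act (Q : zmodType) g (f : hom V Q) : hom V Q :=
  mk_hom (hom_act_subproof g f).

Lemma hom_gmodule (Q : zmodType) : is_gmodule (@hom_act Q).
Proof.
have rM : {morph rho : x y / (x * y)%g} by apply: gmulfM.
have actE g (f : hom V Q) v : hom_act g f v = f ((rho g)^-1%g *m v) by [].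
split=> [g f h|f|g h f]; apply: homP => v //; rewrite !actE.
  by rewrite (morph_1g rM) invg1 mul1mx.
by rewrite rM invgM mulmxA.
Qed.

Definition pairing (Q : zmodType) k (f : k.-tuple G -> hom V Q)
    (c : bar_chain G F m k) : Q := linear_ext f c.

Lemma pairingD (Q : zmodType) k (f : k.-tuple G -> hom V Q) :
  {morph pairing f : x y / x + y}.
Proof. by apply: linear_extD => t; apply: homD. Qed.

Definition boundary1 k (t : k.+1.-tuple G) (v : V) : bar_chain G F m k :=
  \sum_(i < k.+2) (<< bar_coef rho i t v *g bar_face i t >> *~ (-1) ^+ i).

Lemma bar_coefD k (i : 'I_k.+2) (t : k.+1.-tuple G) :
  {morph bar_coef rho i t : x y / x + y}.
Proof. by move=> x y; rewrite /bar_coef; case: ifP => _; rewrite ?mulmxDr. Qed.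

Lemma boundary1D k (t : k.+1.-tuple G) : {morph boundary1 t : x y / x + y}.
Proof.
move=> x y; rewrite /boundary1 -big_split; apply: eq_bigr => i _.
by rewrite bar_coefD monalgUD mulrzDl.
Qed.

Lemma bar_boundaryE k : @bar_boundary G F m rho k = linear_ext (@boundary1 k).
Proof. by []. Qed.

Lemma bar_boundaryD k : {morph @bar_boundary G F m rho k : x y / x + y}.
Proof.
by move=> x y; rewrite !bar_boundaryE linear_extD //; apply: boundary1D.
Qed.

(** The factor rho(g_1)^-1 of the 0-th face is the action of g_1 on Hom(V, Q), so boundary and
    coboundary are adjoint. *)
Lemma pairing_boundary1 (Q : zmodType) k (f : k.-tuple G -> hom V Q) t v :
  pairing f (boundary1 t v) = cobound (@hom_act Q) f t v.
Proof.
rewrite /boundary1 (big_morph _ (pairingD f) (morph_add0 (pairingD f))) hom_eval_sum.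
apply: eq_bigr => i _; rewrite (morph_addMz (pairingD f)) hom_evalMz.
rewrite /pairing linear_extU; last by move=> s; apply: homD.
by rewrite /bar_coef (morph_Vg (@gmulfM _ _ rho)); case: ifP.
Qed.

Lemma pairing_boundary (Q : zmodType) k (f : k.-tuple G -> hom V Q) c :
  pairing f (bar_boundary rho c) = pairing (cobound (@hom_act Q) f) c.
Proof.
rewrite bar_boundaryE /linear_ext (big_morph _ (pairingD f) (morph_add0 (pairingD f))).
by apply: eq_bigr => t _; rewrite pairing_boundary1.
Qed.

Lemma bar_boundary_edge (g : G) (s : 0.-tuple G) (v : V) :
  bar_boundary rho << v *g [tuple of g :: s] >> =
  << SLval (rho g)^-1%g *m v - v *g s >>.
Proof.
rewrite bar_boundaryE linear_extU; last exact: boundary1D.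
have face_s (i : 'I_2) (t : 1.-tuple G) : bar_face i t = s.
  by rewrite [LHS]tuple0 [RHS]tuple0.
rewrite /boundary1 !big_ord_recl big_ord0 addr0 /bar_coef /= theadE !face_s.
rewrite expr0 expr1 mulr1z mulrN1z.
by rewrite -monalgUB (morph_Vg (@gmulfM _ _ rho)).
Qed.

(** Supplies an explicit 1-cycle on which a crossed homomorphism can be evaluated to detect nonzero
    first homology. *)
Lemma two_edge_cycle (g h : G) (u v : V) (s : 0.-tuple G) :
    SLval (rho g)^-1%g *m u - u + (SLval (rho h)^-1%g *m v - v) = 0 ->
  exists2 c : bar_chain G F m 1, bar_boundary rho c = 0 &
    forall (Q : zmodType) (f : 1.-tuple G -> hom V Q),
      pairing f c = f [tuple of g :: s] u + f [tuple of h :: s] v.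
Proof.
move=> guhv; exists (<< u *g [tuple of g :: s] >> + << v *g [tuple of h :: s] >>).
  by rewrite bar_boundaryD !bar_boundary_edge -monalgUD guhv monalgU0.
move=> Q f; have fD t : {morph f t : x y / x + y} by apply: homD.
by rewrite pairingD /pairing !linear_extU.
Qed.

Section BoundaryQuotient.
Variable k : nat.
Notation C := (bar_chain G F m k).

Definition is_boundary : {pred C} :=
  [pred c : C | `[< exists d, bar_boundary rho d = c >]].

Fact is_boundary_closed : zmod_closed is_boundary.
Proof.
have bD := @bar_boundaryD k.
split=> [|c d]; rewrite !inE /=; first by apply/asboolP; exists 0; apply: morph_add0 bD.
move=> /asboolP [x <-] /asboolP [y <-]; apply/asboolP; exists (x - y).
by rewrite bD (morph_addN bD).
Qed.
HB.instance Definition _ := GRing.isZmodClosed.Build C is_boundary is_boundary_closed.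

Definition mod_boundary : zmodType := Quotient.quot is_boundary.

Definition chain_class (c : C) : mod_boundary := \pi_(Quotient.quot is_boundary)%qT c.

Lemma chain_classD : {morph chain_class : x y / x + y}.
Proof. by move=> x y; rewrite /chain_class raddfD. Qed.

Lemma chain_class_eq0 c : chain_class c = 0 -> exists d, bar_boundary rho d = c.
Proof.
move=> c0; apply/asboolP; have : c \in is_boundary; last by rewrite inE.
by rewrite -[c]subr0 Quotient.idealrBE; apply/eqP; rewrite raddf0.
Qed.

Fact tautological_subproof (t : k.-tuple G) :
  {morph (fun v : V => chain_class << v *g t >>) : x y / x + y}.
Proof. by move=> x y; rewrite monalgUD chain_classD. Qed.

(** Pairing a chain with this cochain returns the class of the chain; it is a cocycle because
    boundaries have class 0. *)
Definition tautological (t : k.-tuple G) : hom V mod_boundary :=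
  mk_hom (tautological_subproof t).

Lemma pairing_tautological c : pairing tautological c = chain_class c.
Proof.
have c0 := morph_add0 chain_classD.
by rewrite [in RHS](monalgE c) (big_morph _ chain_classD c0).
Qed.

End BoundaryQuotient.

Lemma cobound_tautological k t : cobound (@hom_act _) (@tautological k) t = 0.
Proof.
apply: homP => v; rewrite -pairing_boundary1 pairing_tautological.
rewrite hom_eval0.
have -> : boundary1 t v = bar_boundary rho << v *g t >>.
  by rewrite bar_boundaryE linear_extU //; apply: boundary1D.
have : bar_boundary rho << v *g t >> \in @is_boundary k.
  by rewrite inE /=; apply/asboolP; eexists.
rewrite -[X in X \in _]subr0 Quotient.idealrBE => /eqP.
by rewrite raddf0.
Qed.

Lemma homology_vanishesS k :
  (forall Q, coh_vanishes (@hom_act Q) k) -> homology_vanishes rho k.+1.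
Proof.
move=> van c c0; apply: chain_class_eq0; rewrite -pairing_tautological.
have [e eE] := van _ _ (@cobound_tautological k.+1).
have -> : @tautological k.+1 = cobound (@hom_act _) e :> (k.+1.-tuple G -> _).
  by apply: funext => t; rewrite eE.
by rewrite -pairing_boundary c0 (morph_add0 (pairingD e)).
Qed.

(** In degree 0 the cocycle condition says that the values of the tautological cochain are
    invariant; so they are 0, and every chain has class 0. *)
Lemma homology_vanishes0 :
  (forall Q (f : hom V Q), (forall g, hom_act g f = f) -> f = 0) ->
  homology_vanishes rho 0.
Proof.
move=> inv c _; apply: chain_class_eq0; rewrite -pairing_tautological.
have t0 t : tautological t = 0 :> hom V (mod_boundary 0).
  apply: inv => g; apply/eqP; rewrite -subr_eq0 -(cobound_nil (@hom_act _)).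
  by apply/eqP/cobound_tautological.
by rewrite /pairing /linear_ext big1 // => t _; rewrite t0.
Qed.

End Duality.

(** * Matrices with three equal traces *)

Section TwoByTwo.
Variable F : comNzRingType.
Implicit Types X Y : 'M[F]_2.

Lemma mx22P X Y : X 0 0 = Y 0 0 -> X 0 1 = Y 0 1 -> X 1 0 = Y 1 0 ->
  X 1 1 = Y 1 1 -> X = Y.
Proof.
move=> e00 e01 e10 e11; apply/matrixP => i j.
have two (k : 'I_2) : k = 0 \/ k = 1.
  by case: k => -[|[|//]] k; [left|right]; apply: val_inj.
by case: (two i) => ->; case: (two j) => ->.
Qed.

Lemma mul22E X Y i j : (X * Y) i j = X i 0 * Y 0 j + X i 1 * Y 1 j.
Proof.
rewrite -mulmxE mxE !big_ord_recl big_ord0 addr0; congr (_ + X _ _ * Y _ _);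
  exact: val_inj.
Qed.

Lemma tr22E X : \tr X = X 0 0 + X 1 1.
Proof.
rewrite /mxtrace !big_ord_recl big_ord0 addr0; congr (_ + X _ _); exact: val_inj.
Qed.

Lemma det22E X : \det X = X 0 0 * X 1 1 - X 0 1 * X 1 0.
Proof.
rewrite (expand_det_row _ 0) !big_ord_recl big_ord0 addr0 /cofactor !det_mx11 !mxE.
rewrite /= expr0 expr1 mul1r mulN1r mulrN.
by congr (_ * X _ _ - X _ _ * X _ _); apply: val_inj.
Qed.

Lemma mul_scalar22 (c : F) X : c%:M * X = c *: X.
Proof. exact: mul_scalar_mx. Qed.

Lemma Cayley_Hamilton22 X : X * X = \tr X *: X - (\det X)%:M.
Proof.
rewrite tr22E det22E; apply: mx22P; rewrite mul22E !mxE /=; ring.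
Qed.

Lemma polarized_Cayley_Hamilton22 X Y :
  X * Y + Y * X = \tr X *: Y + \tr Y *: X + (\tr (X * Y) - \tr X * \tr Y)%:M.
Proof.
have := mul22E Y X; have := mul22E X Y; move: (X * Y) (Y * X) => P Q e1 e2.
by apply: mx22P; rewrite !tr22E !mxE !e1 !e2 /=; ring.
Qed.

End TwoByTwo.

Lemma mul22_scalar (F : comNzRingType) (c : F) (X : 'M[F]_2) : X * c%:M = c *: X.
Proof. exact: mul_mx_scalar. Qed.

Section QuaternionBasis.
Variables (F : fieldType) (x : F) (A B : 'M[F]_2).
Hypotheses (detA : \det A = 1) (detB : \det B = 1).
Hypotheses (trA : \tr A = x) (trB : \tr B = x) (trAB : \tr (A * B) = x).

(** Coordinates with respect to 1, A, B, AB. Cayley-Hamilton and its polarization give the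
    multiplication table with x as only parameter, so matrix identities become polynomial ones. *)
Definition quat (a b c d : F) : 'M[F]_2 := a%:M + b *: A + c *: B + d *: (A * B).

Lemma quat_mull a b c d : A * quat a b c d = quat (- b) (a + x * b) (- d) (c + x * d).
Proof.
rewrite /quat !mulrDr -!scalerAr mulrA Cayley_Hamilton22 detA trA.
rewrite mulrDl mulNr -scalerAl mul_scalar22 mul22_scalar scale1r.
by apply/matrixP => i j; move: (A * B) => C; rewrite !mxE;
  case: (i == j); rewrite ?mulr1n ?mulr0n; ring.
Qed.

Lemma quat_mulBA : B * A = quat (x - x ^+ 2) x x (- 1).
Proof.
apply: (addrI (A * B)); rewrite polarized_Cayley_Hamilton22 trA trB trAB.
apply/matrixP => i j; rewrite /quat; move: (A * B) => C; rewrite !mxE.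
by case: (i == j); rewrite ?mulr1n ?mulr0n; ring.
Qed.

Lemma quat_mulBl a b c d : B * quat a b c d =
  quat (- c + b * (x - x ^+ 2) - x * d) (b * x + d) (a + b * x + c * x + x * d) (- b).
Proof.
have BAB : B * (A * B) = quat (- x) 1 x 0.
  rewrite mulrA quat_mulBA /quat !mulrDl -!scalerAl -mulrA Cayley_Hamilton22.
  rewrite detB trB mulrBr -scalerAr mul22_scalar mul_scalar22 scale1r.
  apply/matrixP => i j; move: (A * B) => C; rewrite !mxE.
  by case: (i == j); rewrite ?mulr1n ?mulr0n; ring.
rewrite {1}/quat !mulrDr -!scalerAr BAB quat_mulBA Cayley_Hamilton22 detB trB.
rewrite mul22_scalar /quat.
by apply/matrixP => i j; move: (A * B) => C; rewrite !mxE;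
  case: (i == j); rewrite ?mulr1n ?mulr0n; ring.
Qed.

Lemma quat_mul a b c d a' b' c' d' : quat a b c d * quat a' b' c' d' =
  quat (a * a' - b * b' + c * (- c' + b' * (x - x ^+ 2) - x * d') - d * (b' * x + d'))
    (a * b' + b * (a' + x * b') + c * (b' * x + d')
      + d * (- c' + b' * (x - x ^+ 2) - x * d' + x * (b' * x + d')))
    (a * c' - b * d' + c * (a' + b' * x + c' * x + x * d') + d * b')
    (a * d' + b * (c' + x * d') - c * b' + d * (a' + c' * x + x * d')).
Proof.
rewrite {1}/quat !mulrDl -!scalerAl -mulrA quat_mulBl !quat_mull.
rewrite mul_scalar22 /quat.
by apply/matrixP => i j; move: (A * B) => C; rewrite !mxE;
  case: (i == j); rewrite ?mulr1n ?mulr0n; ring.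
Qed.

Lemma quatD a b c d a' b' c' d' :
  quat a b c d + quat a' b' c' d' = quat (a + a') (b + b') (c + c') (d + d').
Proof. by rewrite /quat; apply/matrixP => i j; move: (A * B) => C; rewrite !mxE;
  case: (i == j); rewrite ?mulr1n ?mulr0n; ring. Qed.

Lemma quatZ k a b c d : k *: quat a b c d = quat (k * a) (k * b) (k * c) (k * d).
Proof.
by rewrite /quat; apply/matrixP => i j; move: (A * B) => C; rewrite !mxE;
  case: (i == j); rewrite ?mulr1n ?mulr0n; ring.
Qed.

Lemma quatN a b c d : - quat a b c d = quat (- a) (- b) (- c) (- d).
Proof. by rewrite -scaleN1r quatZ !mulN1r. Qed.

Lemma quat1 a : quat a 0 0 0 = a%:M.
Proof. by rewrite /quat !scale0r !addr0. Qed.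

Lemma quatA : quat 0 1 0 0 = A.
Proof. by rewrite /quat !scale0r scale1r raddf0 add0r !addr0. Qed.

Lemma quatB : quat 0 0 1 0 = B.
Proof. by rewrite /quat !scale0r scale1r raddf0 !add0r !addr0. Qed.

Lemma quat_det a b c d : \det (quat a b c d) =
  a ^+ 2 + b ^+ 2 + c ^+ 2 + d ^+ 2 + a * (b + c + d) * x + b * c * (x ^+ 2 - x)
  + (b + c) * d * x.
Proof.
have -> : \det (quat a b c d) =
  a ^+ 2 + b ^+ 2 * \det A + c ^+ 2 * \det B + d ^+ 2 * \det A * \det B
  + a * b * \tr A + a * c * \tr B + a * d * \tr (A * B)
  + b * c * (\tr A * \tr B - \tr (A * B))
  + b * d * \det A * \tr B + c * d * \det B * \tr A.
  rewrite /quat !det22E !tr22E; have := mul22E A B; move: (A * B) => C e.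
  by rewrite !mxE !e /=; ring.
by rewrite detA detB trA trB trAB; ring.
Qed.

Lemma quat_tr a b c d : \tr (quat a b c d) = 2 * a + (b + c + d) * x.
Proof.
by rewrite /quat !raddfD /= !mxtraceZ mxtrace_scalar trA trB trAB; ring.
Qed.

(** Irreducibility makes this determinant nonzero, which turns x + 1 and x - 2 into legitimate
    denominators. *)
Lemma quat_commutator_det : \det (A * B - B * A) = (x + 1) * (x - 2) ^+ 2.
Proof.
have -> : A * B = quat 0 0 0 1 by rewrite /quat !scale0r scale1r raddf0 !add0r.
rewrite quat_mulBA quatN quatD quat_det; ring.
Qed.

Section FoxMatrix.
Variables (A' B' W W' Wn : 'M[F]_2) (s r : F).
Hypotheses (AK : A * A' = 1) (BK : B * B' = 1).
Hypotheses (WE : W = A * B' * A' * B) (W'E : W' = B' * A * B * A').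
Hypotheses (WnE : Wn = s *: W - r%:M) (detWn : \det Wn = 1).
Hypotheses (rel : A * Wn = Wn * B) (irr : \det (A * B - B * A) != 0).

Lemma quat_invA : A' = quat x (- 1) 0 0.
Proof.
have e : quat x (- 1) 0 0 * A = 1.
  by rewrite -[X in _ * X]quatA quat_mul -[RHS]quat1; congr quat; ring.
by rewrite -[LHS]mul1r -e -mulrA AK mulr1.
Qed.

Lemma quat_invB : B' = quat x 0 (- 1) 0.
Proof.
have e : quat x 0 (- 1) 0 * B = 1.
  by rewrite -[X in _ * X]quatB quat_mul -[RHS]quat1; congr quat; ring.
by rewrite -[LHS]mul1r -e -mulrA BK mulr1.
Qed.

Lemma quat_AB' : A * B' = quat 0 x 0 (- 1).
Proof. by rewrite -{1}quatA quat_invB quat_mul; congr quat; ring. Qed.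

Lemma quat_A'B : A' * B = quat 0 0 x (- 1).
Proof. by rewrite quat_invA -[X in _ * X]quatB quat_mul; congr quat; ring. Qed.

Lemma quat_W : W = quat (- 1) x x (x - x ^+ 2).
Proof. by rewrite WE -mulrA quat_A'B quat_AB' quat_mul; congr quat; ring. Qed.

Lemma quat_W' : W' = quat (3 * x ^+ 2 - x ^+ 3 - 1) (- x) (- x) (x ^+ 2 - x).
Proof.
have e : quat (3 * x ^+ 2 - x ^+ 3 - 1) (- x) (- x) (x ^+ 2 - x) * W = 1.
  by rewrite quat_W quat_mul -[RHS]quat1; congr quat; ring.
have A'K : A' * A = 1 by apply: mulmx1C.
have B'K : B' * B = 1 by apply: mulmx1C.
have WK : W * W' = 1.
  rewrite WE W'E -!mulrA (mulrA B) BK mul1r (mulrA A') A'K mul1r (mulrA B') B'K.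
  by rewrite mul1r AK.
by rewrite -[LHS]mul1r -e -mulrA WK mulr1.
Qed.

Lemma trace_ne2 : x - 2 != 0.
Proof.
by apply: contra irr; rewrite quat_commutator_det => /eqP ->; rewrite expr0n mulr0.
Qed.

Lemma trace_neN1 : x + 1 != 0.
Proof.
by apply: contra irr; rewrite quat_commutator_det => /eqP ->; rewrite mul0r.
Qed.

(** In coordinates A W - W B = (x - 1)(A - B), so the relation becomes ((x - 1) s - r)(A - B) = 0,
    and A = B would make the commutator vanish. *)
Lemma riley : r = (x - 1) * s.
Proof.
have e : A * W - W * B = (x - 1) *: (A - B).
  rewrite quat_W -[A in RHS]quatA -[B in RHS]quatB quatN quatD quatZ quat_mull.
  by rewrite -[B in LHS]quatB quat_mul quatN quatD; congr quat; ring.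
have : ((x - 1) * s - r) *: (A - B) = 0.
  rewrite scalerBl mulrC -scalerA -e -[RHS](subrr (Wn * B)) -{1}rel WnE.
  rewrite mulrBr mulrBl -scalerAr -scalerAl mul22_scalar mul_scalar22.
  rewrite !scalerBr !opprB addrACA [RHS]addrACA; congr (_ + _); exact: addrC.
move/eqP; rewrite scaler_eq0 => /orP [|/eqP AB].
  by rewrite subr_eq0 => /eqP.
case/negP: irr; move/subr0_eq: AB => ->.
by rewrite subrr det0 //.
Qed.

Lemma quat_Wn : Wn = quat (- (x * s)) (x * s) (x * s) (x * s - x ^+ 2 * s).
Proof.
by rewrite WnE quat_W quatZ -quat1 quatN quatD riley; congr quat; ring.
Qed.

Lemma trace_square : (x * (x - 2) * s) ^+ 2 = 1.
Proof. by rewrite -[RHS]detWn quat_Wn quat_det; ring. Qed.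

Lemma trace_A'Wn : \tr (A' * Wn) = - (x * (x - 2) * s).
Proof. by rewrite quat_Wn quat_invA quat_mul quat_tr; ring. Qed.

Lemma A_sub1K : (A - 1) * (A' - 1) = (2 - x)%:M.
Proof.
rewrite quat_invA -[X in (X - 1) * _]quatA -[1 : 'M_2]quat1.
rewrite quatN !quatD quat_mul -quat1.
by congr quat; ring.
Qed.

Lemma W_sub1K : (W - 1) * (W' - 1) = ((x + 1) * (x - 2) ^+ 2)%:M.
Proof.
rewrite quat_W quat_W' -[1 : 'M_2]quat1 quatN !quatD quat_mul -quat1.
by congr quat; ring.
Qed.

Lemma W_sub1KC : (W' - 1) * (W - 1) = ((x + 1) * (x - 2) ^+ 2)%:M.
Proof.
rewrite quat_W quat_W' -[1 : 'M_2]quat1 quatN !quatD quat_mul -quat1.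
by congr quat; ring.
Qed.

(* (W - 1)^-1 A B' (A' - 1): the conjugating element m of [fox_system] for p = 0
   is the image of q under this matrix. *)
Definition fox_conj : 'M[F]_2 :=
  ((x + 1) * (x - 2) ^+ 2)^-1 *: ((W' - 1) * (A * B' * (A' - 1))).

(* The Fox derivative of the relator with respect to b. *)
Definition fox_matrix : 'M[F]_2 := (A - 1) * ((Wn - 1) * fox_conj) - Wn.

Lemma fox_conjE : (W - 1) * fox_conj = A * B' * (A' - 1).
Proof.
rewrite /fox_conj -scalerAr (mulrA (W - 1)) W_sub1K mul_scalar22 scalerA.
rewrite mulVf ?scale1r //.
by rewrite mulf_neq0 ?expf_neq0 ?trace_ne2 ?trace_neN1.
Qed.

Lemma fox_matrixE : fox_matrix =
  ((1 - x * (x - 2) * s) / ((x + 1) * (x - 2))) *: quat (- x) x 2 (- x).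
Proof.
have [n2 n1] := (trace_ne2, trace_neN1).
have T1 : (A - 1) * (Wn - 1) = quat 1 (x ^+ 2 * s - 2 * x * s - 1)
    (x ^+ 2 * s - 2 * x * s) (2 * x ^+ 2 * s - x ^+ 3 * s).
  rewrite quat_Wn -[A]quatA -[1 : 'M_2]quat1 quatN !quatD quat_mul.
  by congr quat; ring.
have T3 : (W' - 1) * (A * B' * (A' - 1)) = quat (2 * x - x ^+ 2) 0 (x - 2) (x - 2).
  rewrite quat_W' quat_AB' quat_invA -[1 : 'M_2]quat1 quatN !quatD !quat_mul.
  by congr quat; ring.
rewrite /fox_matrix /fox_conj (mulrA (A - 1)) T1 -scalerAr T3 quat_mul.
rewrite !quatZ quat_Wn quatN quatD.
by congr quat; field; rewrite n1 n2.
Qed.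

Lemma fox_matrix_eq0 : \tr (A' * Wn) = - 1 -> fox_matrix = 0.
Proof.
rewrite trace_A'Wn => /oppr_inj e; rewrite fox_matrixE e subrr mul0r.
by rewrite scale0r.
Qed.

(** [trace_square] leaves only the value -1 for x (x - 2) s, so the scalar in [fox_matrixE] is 2 /
    ((x + 1)(x - 2)). *)
Lemma fox_matrix_unit : (2 : F) != 0 -> \tr (A' * Wn) != - 1 ->
  exists D, fox_matrix * D = 1 /\ D * fox_matrix = 1.
Proof.
rewrite trace_A'Wn eqr_opp => two ne1.
have [n2 n1] := (trace_ne2, trace_neN1).
have e : x * (x - 2) * s = - 1.
  have /eqP := trace_square; rewrite sqrf_eq1 (negPf ne1) /= => /eqP.
  by [].
have fE : fox_matrix = (2 / ((x + 1) * (x - 2))) *: quat (- x) x 2 (- x).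
  by rewrite fox_matrixE e opprK.
(* [quat (- x) x 2 (- x)] has trace 0 and determinant (x + 1)(x - 2)^2, so its inverse is its
   opposite divided by that determinant. *)
exists ((2 * (x - 2))^-1 *: quat x (- x) (- 2) x); rewrite fE; split.
  rewrite -scalerAl -scalerAr scalerA quat_mul quatZ -[RHS]quat1.
  by congr quat; field; rewrite n1 n2 two.
rewrite -scalerAl -scalerAr scalerA quat_mul quatZ -[RHS]quat1.
by congr quat; field; rewrite n1 n2 two.
Qed.

End FoxMatrix.

End QuaternionBasis.

(** * Representations of twist knot groups *)

Section HomModule.
Variables (F : fieldType) (Q : zmodType).
Notation V := 'cV[F]_2.
Implicit Types (S T : 'M[F]_2) (f : hom V Q).

Fact precomp_subproof T f : {morph (fun v : V => f (T^T *m v)) : x y / x + y}.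
Proof. by move=> x y; rewrite mulmxDr homD. Qed.

(* The transpose makes precomposition a left action. *)
Definition precomp T f : hom V Q := mk_hom (precomp_subproof T f).

Lemma precompE T f v : precomp T f v = f (T^T *m v). Proof. by []. Qed.

Lemma precompM S T f : precomp (S * T) f = precomp S (precomp T f).
Proof. by apply: homP => v; rewrite !precompE -mulmxE trmx_mul mulmxA. Qed.

Lemma precomp1 f : precomp 1 f = f.
Proof. by apply: homP => v; rewrite precompE -[1]/1%:M trmx1 mul1mx. Qed.

Lemma precompDl S T f : precomp (S + T) f = precomp S f + precomp T f.
Proof. by apply: homP => v; rewrite hom_evalD !precompE linearD mulmxDl homD. Qed.

Lemma precompDr S : {morph precomp S : f g / f + g}.
Proof. by move=> f g; apply: homP => v; rewrite hom_evalD !precompE hom_evalD. Qed.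

Lemma precompBl S T f : precomp (S - T) f = precomp S f - precomp T f.
Proof. by apply: (addIr (precomp T f)); rewrite subrK -precompDl subrK. Qed.

Lemma precomp0l f : precomp 0 f = 0.
Proof. by rewrite -(subrr 1) precompBl subrr. Qed.

Lemma precompBr S : {morph precomp S : f g / f - g}.
Proof. by move=> f g; apply: (addIr (precomp S g)); rewrite subrK -precompDr subrK. Qed.

Lemma precomp0r S : precomp S 0 = 0.
Proof. exact: morph_add0 (precompDr S). Qed.

Lemma precomp_sub1 S f : precomp (S - 1) f = precomp S f - f.
Proof. by rewrite precompBl precomp1. Qed.

Lemma precomp_fixed S S' (c : F) f :
  S' * (S - 1) = c%:M -> c != 0 -> precomp S f = f -> f = 0.
Proof.
move=> e c0 Sf; have : precomp ((c^-1)%:M * (S' * (S - 1))) f = 0.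
  rewrite !precompM precomp_sub1 Sf subrr -(precomp0l 0).
  by rewrite -!precompM !mulr0 precomp0l.
by rewrite e mul_scalar22 scale_scalar_mx mulVf // precomp1.
Qed.

End HomModule.

Section CrossedHomomorphisms.
Variables (n : int) (M : zmodType) (act : twist_group n -> M -> M).
Notation G := (twist_group n).
Hypothesis actP : is_gmodule act.
Variable z : G -> M.
Hypothesis zM : forall g h, z (g * h)%g = z g + act g (z h).

Lemma crossed1 : z 1%g = 0.
Proof. by apply: (addrI (z 1%g)); rewrite -{2}(act1 actP (z 1%g)) -zM mulg1 addr0. Qed.

Lemma crossedV g : z g^-1%g = - act g^-1%g (z g).
Proof.
by apply: (addIr (act g^-1%g (z g))); rewrite -zM mulVg crossed1 addNr.
Qed.

Lemma crossed_gexpz g m k : z g = act g m - m -> z (gexpz g k) = act (gexpz g k) m - m.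
Proof.
move=> zg; have zV : z g^-1%g = act g^-1%g m - m.
  by rewrite crossedV zg (actB actP) (actK actP) opprB.
elim/int_rect: k => [|k IHk|k IHk]; first by rewrite crossed1 (act1 actP) subrr.
  by rewrite intS gexpzS zM IHk zg (actB actP) (actM actP) addrC addrA subrK.
by rewrite intS opprD gexpzB1 zM IHk zV (actB actP) (actM actP) addrC addrA subrK.
Qed.

Lemma crossed_eq0 : z (twist_a n) = 0 -> z (twist_b n) = 0 -> forall g, z g = 0.
Proof.
move=> za zb; elim/twist_group_ind => [|g IH|g IH|g IH|g IH].
- exact: crossed1.
- by rewrite zM IH za (act0 actP) addr0.
- by rewrite zM IH crossedV za !(act0 actP) oppr0 addr0.
- by rewrite zM IH zb (act0 actP) addr0.
- by rewrite zM IH crossedV zb !(act0 actP) oppr0 addr0.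
Qed.

(** Converse of [crossed_hom_extension]: z is applied to the definition of w and to the relation,
    and being principal at w passes to the powers of w. *)
Lemma crossed_fox m (w := twist_w n) : z w = act w m - m ->
  fox_system act n (twist_a n) (twist_b n) (z (twist_a n)) (z (twist_b n)) m 0.
Proof.
move=> zw; split.
  rewrite -zw /w /twist_w !zM !crossedV !(actB actP, actN actP, actM actP).
  rewrite -!addrA; congr (_ + _).
  by rewrite addrC [- _ - _]addrC -addrA.
have := congr1 z (twist_relation n); rewrite !zM (crossed_gexpz _ zw) => e.
by rewrite -addrA -opprD e subrr.
Qed.

End CrossedHomomorphisms.

Section SpecialLinear22.
Variable F : fieldType.
Implicit Types X Y : 'SL_2[F].

Lemma SLval_mul X Y : SLval (X * Y)%g = (SLval X * SLval Y)%R. Proof. by []. Qed.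
Lemma SLval_one : SLval (1%g : 'SL_2[F]) = 1. Proof. by []. Qed.

Lemma SLval_inv X : SLval X^-1%g = (\tr X)%:M - SLval X.
Proof.
have e : SLval X * ((\tr X)%:M - SLval X) = 1.
  rewrite mulrBr Cayley_Hamilton22 SL_det mul22_scalar.
  by rewrite opprB addrC subrK.
by rewrite -[LHS]mulr1 -e mulrA -SLval_mul mulVg mul1r.
Qed.

Lemma tr_SLval_inv X : \tr (SLval X^-1%g) = \tr X.
Proof. by rewrite SLval_inv linearB /= mxtrace_scalar; ring. Qed.

Lemma SL_sqr X : SLval X * SLval X = \tr X *: SLval X - 1%:M.
Proof. by rewrite Cayley_Hamilton22 SL_det. Qed.

Lemma SL_gexpz X k : exists s r, SLval (gexpz X k) = s *: SLval X - r%:M.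
Proof.
elim/int_rect: k => [|k [s [r IHk]]|k [s [r IHk]]].
- by exists 0, (- 1); rewrite scale0r raddfN opprK add0r.
- exists (s * \tr X - r), s; rewrite intS gexpzS SLval_mul IHk mulrBr mul22_scalar.
  rewrite -scalerAr SL_sqr; apply/matrixP => i j; rewrite !mxE.
  by case: (i == j); rewrite ?mulr1n ?mulr0n; ring.
- exists r, (\tr X * r - s); rewrite intS opprD gexpzB1 SLval_mul SLval_inv IHk.
  rewrite mulrBl mul_scalar22 mulrBr mul22_scalar -scalerAr SL_sqr.
  apply/matrixP => i j; rewrite !mxE.
  by case: (i == j); rewrite ?mulr1n ?mulr0n; ring.
Qed.

(** For trace t = 1 or -1, Cayley-Hamilton gives X^3 = -t. That 2 is nonzero separates 1 from -1;
    that 3 is nonzero excludes X = 1, whose trace is 2. *)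
Lemma SL_order3 X : (2 : F) != 0 -> (3 : F) != 0 ->
  \tr X = 1 \/ \tr X = - 1 -> has_order X 3 <-> \tr X = - 1.
Proof.
move=> two three trX.
have cube : SLval (X ^+ 3)%g = (\tr X ^+ 2 - 1) *: SLval X - (\tr X)%:M.
  rewrite 2!expgS expg1 !SLval_mul SL_sqr mulrBr mul22_scalar -scalerAr SL_sqr.
  apply/matrixP => i j; rewrite !mxE.
  by case: (i == j); rewrite ?mulr1n ?mulr0n; ring.
split=> [[_ X3 _]|tX].
  case: trX => // t1; move: cube; rewrite X3 t1 SLval_one => /matrixP/(_ 0 0).
  rewrite !mxE expr1n subrr mul0r /= mulr1n => /eqP.
  by rewrite sub0r -subr_eq0 opprK (negPf two).
have X3 : (X ^+ 3)%g = 1%g.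
  apply: val_inj; rewrite [LHS]cube tX sqrrN expr1n subrr scale0r sub0r.
  by rewrite raddfN opprK.
have X1 : X <> 1%g.
  move=> X1; move: tX; rewrite X1 mxtrace1 => /eqP; rewrite -subr_eq0 opprK.
  by rewrite (_ : 2%:R + 1 = 3 :> F) ?(negPf three) //; ring.
split=> //; case=> [|[|[|e]]] // _.
by move=> X2; apply: X1; rewrite -X3 expgS X2 mulg1.
Qed.

End SpecialLinear22.

Section Irreducible.
Variables (F : numClosedFieldType) (n : int).
Variable rho : {multiplicative twist_group n -> 'SL_2[F]}.
Hypothesis irr : irreducible_rep rho.
Notation A := (SLval (rho (twist_a n))).
Notation B := (SLval (rho (twist_b n))).

Let rhoM : {morph rho : x y / (x * y)%g} := gmulfM.

(** The kernel of [X] is stable under A and B, hence under the whole group because A^-1 = tr A - A.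
    Being nonzero, it is everything by irreducibility. *)
Lemma kernel_dichotomy (X : 'M[F]_2) :
    (forall v : 'cV[F]_2, X *m v = 0 -> X *m (A *m v) = 0 /\ X *m (B *m v) = 0) ->
  \det X = 0 -> X = 0.
Proof.
move=> inv /eqP; rewrite -det_tr => /det0P [u u0 uX].
pose U := lker (linfun (mulmx X : 'cV[F]_2 -> 'cV[F]_2)).
have memU v : (v \in U) = (X *m v == 0) by rewrite memv_ker lfunE.
have stable g v : v \in U -> rho g *m v \in U.
  move: g v; elim/twist_group_ind => [v|g IH v|g IH v|g IH v|g IH v] Uv.
  - by rewrite (morph_1g rhoM) mul1mx.
  - rewrite rhoM -mulmxA memU.
    by have := IH v Uv; rewrite memU => /eqP /inv [-> _].
  - rewrite rhoM -mulmxA memU (morph_Vg rhoM) SLval_inv mulmxBl mulmxBr.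
    have := IH v Uv; rewrite memU => /eqP Xv; have [-> _] := inv _ Xv.
    by rewrite mul_scalar_mx -scalemxAr Xv scaler0 subrr.
  - rewrite rhoM -mulmxA memU.
    by have := IH v Uv; rewrite memU => /eqP /inv [_ ->].
  - rewrite rhoM -mulmxA memU (morph_Vg rhoM) SLval_inv mulmxBl mulmxBr.
    have := IH v Uv; rewrite memU => /eqP Xv; have [_ ->] := inv _ Xv.
    by rewrite mul_scalar_mx -scalemxAr Xv scaler0 subrr.
case: (irr stable) => [U0|Uf].
  have : u^T \in U by rewrite memU -[X]trmxK -trmx_mul uX trmx0.
  by rewrite U0 memv0 -(inj_eq trmx_inj) trmxK trmx0 (negPf u0).
apply/matrixP => i j; rewrite [RHS]mxE.
have : delta_mx j 0 \in U by rewrite Uf memvf.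
by rewrite memU -colE => /eqP/matrixP/(_ i 0); rewrite !mxE.
Qed.

Lemma schur (X : 'M[F]_2) : X *m A = A *m X -> X *m B = B *m X ->
  exists c, X = c%:M.
Proof.
move=> XA XB; have [c /eigenvalueP [u uX u0]] : exists c, eigenvalue X c.
  exact: eigenvalue_closed.
exists c; apply/eqP; rewrite -subr_eq0; apply/eqP/kernel_dichotomy.
  move=> v; rewrite !mulmxBl !mul_scalar_mx => /eqP; rewrite subr_eq0 => /eqP Xv.
  by rewrite !mulmxA XA XB -!mulmxA Xv -!scalemxAr !subrr.
by apply/eqP/det0P; exists u; rewrite // mulmxBr mul_mx_scalar uX subrr.
Qed.

(** A singular commutator vanishes by [kernel_dichotomy]; then A and B are scalar by [schur]. *)
Lemma irreducible_commutator : \det (A * B - B * A) != 0.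
Proof.
apply/eqP => det0.
have AB : A *m B = B *m A.
  apply/eqP; rewrite -subr_eq0; apply/eqP/kernel_dichotomy => //.
  (* ker C is stable under A and B because C A = tr(A) C - A C, C B = tr(B) C - B C. *)
  have anti (Y : 'M[F]_2) C : \tr C = 0 -> \tr (Y * C) = 0 ->
      C * Y = \tr Y *: C - Y * C.
    move=> tC tYC; apply/eqP; rewrite eq_sym subr_eq addrC; apply/eqP.
    by rewrite polarized_Cayley_Hamilton22 tC tYC scale0r mulr0 subrr raddf0 !addr0.
  set C : 'M_2 := A * B - B * A.
  have tC : \tr C = 0 by rewrite /C linearB /= (mxtrace_mulC A B) subrr.
  have CA : C * A = \tr A *: C - A * C.
    apply: anti => //; rewrite /C mulrBr linearB /=.
    by rewrite (mxtrace_mulC A (A *m B)) -mulmxA subrr.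
  have CB : C * B = \tr B *: C - B * C.
    apply: anti => //; rewrite /C mulrBr linearB /=.
    by rewrite [X in _ - X](mxtrace_mulC B (B *m A)) -mulmxA subrr.
  move=> v Cv; rewrite !mulmxA.
  rewrite -[C *m A]/(C * A) -[C *m B]/(C * B) CA CB !mulmxBl -!scalemxAl Cv.
  by rewrite -!mulmxE -!mulmxA Cv !mulmx0 !scaler0 subrr.
have [c Ac] := schur (erefl (A *m A)) AB.
have [d Bd] := schur (esym AB) (erefl (B *m B)).
(* Every subspace is stable, so a nonzero singular matrix contradicts irreducibility. *)
pose E : 'M[F]_2 := delta_mx 0 0.
have : E = 0.
  apply: kernel_dichotomy; last by rewrite det22E !mxE /= mulr0 mul0r subrr.
  by move=> v Ev; rewrite Ac Bd !mul_scalar_mx -!scalemxAr Ev !scaler0.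
by move/matrixP/(_ 0 0)/eqP; rewrite !mxE eqxx oner_eq0.
Qed.

End Irreducible.

Section TwistRepresentation.
Variables (F : numClosedFieldType) (n : int).
Notation G := (twist_group n).
Notation a := (twist_a n).
Notation b := (twist_b n).
Notation w := (twist_w n).
Notation wn := (gexpz w n).
Variable rho : {multiplicative G -> 'SL_2[F]}.
Hypothesis irr : irreducible_rep rho.
Hypothesis tr_ab : \tr (rho a) = \tr (rho (a * b)%g).

Let rhoM : {morph rho : x y / (x * y)%g} := gmulfM.
Let x := \tr (rho a).

(** The contragredient representation: it has the same traces as rho, and [precomp] along it is the
    action on Hom(V, Q). *)
Definition dual_rep (g : G) : 'M[F]_2 := (SLval (rho g)^-1%g)^T.
Local Notation R := dual_rep.

Lemma dual_repM : {morph R : g h / (g * h)%g >-> g * h}.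
Proof. by move=> g h; rewrite /R rhoM invgM SLval_mul -mulmxE trmx_mul. Qed.

Lemma dual_rep1 : R 1%g = 1.
Proof. by rewrite /R (morph_1g rhoM) invg1 trmx1. Qed.

Lemma dual_rep_tr g : \tr (R g) = \tr (rho g).
Proof. by rewrite /R mxtrace_tr tr_SLval_inv. Qed.

Lemma dual_rep_det g : \det (R g) = 1.
Proof. by rewrite /R det_tr SL_det. Qed.

Lemma hom_act_dual (Q : zmodType) g (f : hom 'cV[F]_2 Q) :
  hom_act rho g f = precomp (R g) f.
Proof. by apply: homP => v; rewrite precompE trmxK. Qed.

Lemma tr_b : \tr (rho b) = x.
Proof.
have -> : b = (wn^-1 * (a * wn))%g by rewrite twist_relation mulKg.
have trC (X Y : 'M[F]_2) : \tr (X * Y) = \tr (Y * X) := mxtrace_mulC X Y.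
rewrite !rhoM !SLval_mul trC -mulrA -SLval_mul -rhoM mulgV (morph_1g rhoM).
by rewrite SLval_one mulr1.
Qed.

Let detA : \det (R a) = 1 := dual_rep_det a.
Let detB : \det (R b) = 1 := dual_rep_det b.
Let trA : \tr (R a) = x. Proof. exact: dual_rep_tr. Qed.
Let trB : \tr (R b) = x. Proof. by rewrite dual_rep_tr tr_b. Qed.
Let trAB : \tr (R a * R b) = x.
Proof. by rewrite -dual_repM dual_rep_tr -tr_ab. Qed.

Lemma dual_commutator : \det (R a * R b - R b * R a) != 0.
Proof.
rewrite (quat_commutator_det detA detB trA trB trAB).
rewrite -(@quat_commutator_det _ x (rho a) (rho b)) ?SL_det ?tr_b //.
  exact: irreducible_commutator.
by rewrite /x tr_ab rhoM.
Qed.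

Lemma twist_index_neq0 : n != 0.
Proof.
apply: contra dual_commutator => /eqP n0.
have -> : b = a by have := twist_relation n; rewrite n0 /= mulg1 mul1g.
by rewrite subrr det0.
Qed.

Lemma dual_power : exists s r, R wn = s *: R w - r%:M.
Proof.
(* The exponent is -n because [dual_rep] inverts; the new coefficients come from R w = tr rho(w) -
   rho(w)^T. *)
have [s [r e]] := SL_gexpz (rho w) (- n); exists (- s), (r - s * \tr (rho w)).
have -> : R wn = (SLval (gexpz (rho w) (- n)))^T.
  by rewrite /R (morph_gexpz rhoM) gexpzN.
rewrite e /R SLval_inv; apply/matrixP => i j; rewrite !mxE eq_sym.
by case: (i == j); rewrite ?mulr1n ?mulr0n; ring.
Qed.

Let AK : R a * R a^-1%g = 1. Proof. by rewrite -dual_repM mulgV dual_rep1. Qed.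
Let BK : R b * R b^-1%g = 1. Proof. by rewrite -dual_repM mulgV dual_rep1. Qed.
Let WE : R w = R a * R b^-1%g * R a^-1%g * R b. Proof. by rewrite -!dual_repM. Qed.
Let W'E : R w^-1%g = R b^-1%g * R a * R b * R a^-1%g.
Proof. by rewrite -!dual_repM /twist_w !invgM !invgK !mulgA. Qed.
Let rel : R a * R wn = R wn * R b.
Proof. by rewrite -!dual_repM twist_relation. Qed.

Notation V := 'cV[F]_2.

Lemma fox_system_hom (Q : zmodType) (q m phi : hom V Q) :
  fox_system (@hom_act _ _ _ rho Q) n a b 0 q m phi <->
  precomp (R a * R b^-1%g * (R a^-1%g - 1)) q = precomp (R w - 1) m /\
  precomp (R a - 1) (precomp (R wn - 1) m) - precomp (R wn) q = phi.
Proof.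
rewrite /fox_system -/(twist_w n) subr0 !add0r !hom_act_dual -!precomp_sub1.
by rewrite !precompM.
Qed.

Lemma twist_trace : \tr (rho (a^-1 * wn)%g) = 1 \/ \tr (rho (a^-1 * wn)%g) = - 1.
Proof.
have [s [r WnE]] := dual_power.
have sq := trace_square detA detB trA trB trAB AK BK WE WnE
  (dual_rep_det wn) rel dual_commutator.
rewrite -dual_rep_tr dual_repM (trace_A'Wn detA detB trA trB trAB AK BK WE WnE rel
  dual_commutator).
move/eqP: sq; rewrite sqrf_eq1 => /orP [] /eqP ->; first by right.
by left; rewrite opprK.
Qed.

Let C : 'M[F]_2 := fox_conj x (R a) (R a^-1%g) (R b^-1%g) (R w^-1%g).
Let D : 'M[F]_2 := fox_matrix x (R a) (R a^-1%g) (R b^-1%g) (R w^-1%g) (R wn).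

(** With p = 0 every q is admissible: invertibility of R w - 1 determines m, and phi is then the
    image of q under D. *)
Lemma fox_system_conj (Q : zmodType) (q : hom V Q) :
  fox_system (@hom_act _ _ _ rho Q) n a b 0 q (precomp C q) (precomp D q).
Proof.
have [s [r WnE]] := dual_power.
have CE := fox_conjE detA detB trA trB trAB AK BK WE W'E dual_commutator.
apply/fox_system_hom; split; first by rewrite -precompM CE.
by rewrite -!precompM -precompBl -?mulrA.
Qed.

Let aK : (R a^-1%g - 1) * (R a - 1) = (2 - x)%:M.
Proof.
have AKC : R a^-1%g * R a = 1 by rewrite -dual_repM mulVg dual_rep1.
have := A_sub1K detA detB trA trB trAB AK.
rewrite !mulrBl !mulrBr AK AKC !mulr1 !mul1r => <-.
by rewrite !opprB addrACA [RHS]addrACA [- _ + _]addrC.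
Qed.

Let x2 : 2 - x != 0.
Proof.
rewrite -opprB oppr_eq0.
exact: (trace_ne2 detA detB trA trB trAB dual_commutator).
Qed.

Lemma hom_no_invariants (Q : zmodType) (f : hom V Q) :
  (forall g, hom_act rho g f = f) -> f = 0.
Proof.
by move=> inv; apply: (precomp_fixed aK x2); rewrite -hom_act_dual.
Qed.

Let wK : exists2 c : F, (R w^-1%g - 1) * (R w - 1) = c%:M & c != 0.
Proof.
exists ((x + 1) * (x - 2) ^+ 2).
  exact: (W_sub1KC detA detB trA trB trAB AK BK WE W'E).
by rewrite -(quat_commutator_det detA detB trA trB trAB) dual_commutator.
Qed.

Section InvertibleFoxMatrix.
Variable D' : 'M[F]_2.
Hypotheses (DK : D * D' = 1) (DK' : D' * D = 1).

Lemma hom_coh_vanishes1 (Q : zmodType) : coh_vanishes (@hom_act _ _ _ rho Q) 1.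
Proof.
apply: coh_vanishes1; first exact: hom_gmodule.
move=> phi; exists 0, (precomp D' phi), (precomp C (precomp D' phi)).
have := fox_system_conj (precomp D' phi).
by rewrite -(precompM D) DK precomp1.
Qed.

Lemma hom_coh_vanishes0 (Q : zmodType) : coh_vanishes (@hom_act _ _ _ rho Q) 0.
Proof.
move=> f f0; have actP := hom_gmodule rho Q.
pose z0 g := f [tuple of g :: [tuple]].
have z0M g h : z0 (g * h)%g = z0 g + hom_act rho g (z0 h).
  have := f0 [tuple of g :: [tuple of h :: [tuple]]].
  rewrite cobound_cons cobound_nil addrfctE opprfctE /coind /slice.
  by move/eqP; rewrite subr_eq0 => /eqP e; rewrite /z0 e [RHS]addrC subrK.
(* As R a - 1 is invertible, subtracting the principal crossed homomorphism of [m0] makes the value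
   at a vanish. *)
pose m0 := precomp ((2 - x)^-1%:M * (R a^-1%g - 1)) (z0 a).
pose z g := z0 g - (hom_act rho g m0 - m0).
have zM g h : z (g * h)%g = z g + hom_act rho g (z h).
  rewrite /z z0M (actM actP) !(actB actP) !opprB !addrA.
  by congr (_ - _); rewrite [RHS]addrAC subrK addrAC.
have za : z a = 0.
  rewrite /z hom_act_dual -precomp_sub1 -precompM mulrA mul22_scalar -scalerAl.
  rewrite (A_sub1K detA detB trA trB trAB AK) scale_scalar_mx mulVf //.
  by rewrite precomp1 subrr.
pose c := (x + 1) * (x - 2) ^+ 2.
have c0 : c != 0.
  by rewrite /c -(quat_commutator_det detA detB trA trB trAB) dual_commutator.
(* Likewise R w - 1 is invertible, so z is principal at w. *)
pose m := precomp (c^-1%:M * (R w^-1%g - 1)) (z w).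
have zw : z w = hom_act rho w m - m.
  rewrite hom_act_dual -precomp_sub1 -precompM mulrA mul22_scalar -scalerAl.
  rewrite (W_sub1K detA detB trA trB trAB AK BK WE W'E) scale_scalar_mx mulVf //.
  by rewrite precomp1.
have := crossed_fox actP zM zw; rewrite za => /fox_system_hom [e1 e2].
have /fox_system_hom [e3 e4] := fox_system_conj (z b).
(* The first Fox equation determines m, so the second one says that D kills z b. *)
have mE : m = precomp C (z b).
  apply/eqP; rewrite -subr_eq0; apply/eqP.
  have [d wK' d0] := wK; apply: (precomp_fixed wK' d0); apply/eqP.
  by rewrite -subr_eq0 -precomp_sub1 precompBr -e1 -e3 subrr.
have zb : z b = 0.
  rewrite -[z b]precomp1 -DK' precompM -e4 -mE e2 precomp0r.
  by [].
have z_eq0 := crossed_eq0 actP zM za zb.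
exists (fun=> m0) => t; case/tupleP: t => g t.
rewrite cobound_nil (tuple0 t); apply/esym/eqP; rewrite -subr_eq0; apply/eqP.
exact: z_eq0.
Qed.

Lemma twist_acyclic : acyclic_rep rho.
Proof.
case=> [|[|[|k]]].
- exact/homology_vanishes0/hom_no_invariants.
- exact/homology_vanishesS/hom_coh_vanishes0.
- exact/homology_vanishesS/hom_coh_vanishes1.
- apply: homology_vanishesS => Q.
  apply: coh_vanishes_high; [exact: twist_index_neq0 | exact: hom_gmodule].
Qed.

End InvertibleFoxMatrix.

(** If D = 0, any q is the value at b of a crossed homomorphism vanishing at a. Its pairing with
    boundaries is 0, but with the cycle built here it is q v = 1. *)
Lemma twist_not_acyclic : D = 0 -> ~ acyclic_rep rho.
Proof.
move=> D0 /(_ 1) van; have actP := hom_gmodule rho F.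
have qD : {morph (fun v : V => v 0 0) : u v / u + v}.
  by move=> u v; rewrite mxE.
pose q := mk_hom qD.
have sys := fox_system_conj q; rewrite D0 precomp0l in sys.
have [z [zM za zb]] := crossed_hom_extension actP sys.
pose f (t : 1.-tuple G) := z (thead t).
have f0 t : cobound (@hom_act _ _ _ rho F) f t = 0.
  case/tupleP: t => g t; case/tupleP: t => h t; rewrite cobound_cons cobound_nil.
  rewrite addrfctE opprfctE /coind /slice /f !theadE zM.
  by rewrite [z g + _]addrC addrK subrr.
pose v : V := delta_mx 0 0.
(* The edge labelled a must compensate the boundary of the edge labelled b; rho(a)^-1 - 1 has
   inverse (rho(a) - 1) / (2 - x). *)
pose u : V := (2 - x)^-1 *: ((SLval (rho a) - 1) *m (v - SLval (rho b)^-1%g *m v)).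
have uE : SLval (rho a)^-1%g *m u - u = v - SLval (rho b)^-1%g *m v.
  have aE : (SLval (rho a)^-1%g - 1) * (SLval (rho a) - 1) = (2 - x)%:M.
    rewrite !mulrBl !mulrBr mul1r !mulr1 -SLval_mul mulVg SLval_one SLval_inv.
    apply/matrixP => i j; rewrite !mxE -/x.
    by case: (i == j); rewrite ?mulr1n ?mulr0n; ring.
  rewrite -[X in _ - X]mul1mx -mulmxBl /u -scalemxAr mulmxA -[_ *m (_ - 1)]/(_ * _) aE.
  by rewrite mul_scalar_mx scalerA mulVf // scale1r.
have guhv : SLval (rho a)^-1%g *m u - u + (SLval (rho b)^-1%g *m v - v) = 0.
  by rewrite uE addrC addrA subrK subrr.
have [c c0 pc] := two_edge_cycle [tuple] guhv.
have [d dc] := van c c0.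
have : pairing f c = 0.
  rewrite -dc pairing_boundary /pairing /linear_ext big1 // => t _.
  by rewrite f0.
rewrite pc /f !theadE za zb hom_eval0 add0r /= mxE !eqxx => /eqP.
by rewrite oner_eq0.
Qed.

(** By [twist_trace] and [SL_order3], order 3 means trace -1, the case in which the Fox matrix
    vanishes instead of being invertible. *)
Lemma twist_nonacyclicP :
  ~ acyclic_rep rho <-> has_order (rho (a^-1 * wn)%g) 3.
Proof.
have two : (2 : F) != 0 by rewrite pnatr_eq0.
have three : (3 : F) != 0 by rewrite pnatr_eq0.
apply: iff_trans (iff_sym (SL_order3 two three twist_trace)).
have [s [r WnE]] := dual_power; rewrite -dual_rep_tr dual_repM.
split=> [nac|tr]; last first.
  apply: twist_not_acyclic.
  exact: (fox_matrix_eq0 detA detB trA trB trAB AK BK WE W'E WnE rel dual_commutator).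
apply: contrapT => /eqP ntr; case: nac.
have [D' [DK DK']] := fox_matrix_unit detA detB trA trB trAB AK BK WE W'E WnE
  (dual_rep_det wn) rel dual_commutator two ntr.
exact: (twist_acyclic DK DK').
Qed.

End TwistRepresentation.

Theorem theoremD (R : realType) (n : int)
    (rho : {multiplicative twist_group n -> 'SL_2[R[i]]}) :
  irreducible_rep rho ->
  \tr (rho (twist_a n)) = \tr (rho (twist_a n * twist_b n)%g) ->
  ~ acyclic_rep rho <->
  has_order (rho ((twist_a n)^-1 * gexpz (twist_w n) n)%g) 3.
Proof. exact: twist_nonacyclicP. Qed.
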